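(* Let $I=[0,1]$, let $\{B(s):s\in I\}$ be a standard Brownian motion on a complete probability space $(\Omega,\mathcal F,\mathbb P)$, and let $\{A(s):s\in I\}$ be a stochastic process with continuous paths, adapted to the natural filtration of $B$, with values in $[\underline a,\overline a]$ where $\frac12<\underline a\le\overline a<1$ are deterministic constants. Assume that there are constants $c>0$ and $\rho\in(0,1]$ such that $\mathbb E(|A(x)-A(y)|^2)\le c|x-y|^{2\rho}$ for all $x,y\in I$. For $t\in I$ let $X(t)=\int_0^1(t-s)_+^{A(s)-1/2}\,dB(s)$ (Itô integral). Then the process $\{X(t):t\in I\}$ has a modification whose paths are Hölder continuous functions on $I$ of any order $\zeta\in(0,\underline a-\frac12)$.
   Context: The natural filtration of $B$ is $\mathcal F_s=\sigma(B(u);0\le u\le s)$, $s\in I$. The integrand $(t-s)_+^{A(s)-1/2}$ means $0$ if $t\le s$ and $(t-s)^{A(s)-1/2}$ otherwise. *)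

(* Defs.v *)
From HB Require Import structures.
From mathcomp Require Import all_boot all_order all_algebra.
From mathcomp Require Import all_classical all_reals all_analysis.

Set Implicit Arguments.
Unset Strict Implicit.
Unset Printing Implicit Defensive.
Import Order.TTheory GRing.Theory Num.Theory.
Import numFieldNormedType.Exports.
Local Open Scope classical_set_scope.
Local Open Scope ring_scope.

(* Processes indexed by I = [0, 1] are represented by functions
   X : R -> Omega -> R of which only the values X t with t in `[0, 1] are ever
   constrained or used. *)

Section processes.
Context d (Omega : measurableType d) (R : realType).
Implicit Types (B X : R -> Omega -> R) (G : set (set Omega)).

(* F_s = sigma(B u; 0 <= u <= s); it is not completed. *)
Definition natural_filtration B (s : R) : set (set Omega) :=
  <<s [set E | exists2 u : R, u \in `[0, s] &
               exists2 U : set R, measurable U & E = B u @^-1` U] >>.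

Definition rv_measurable_wrt G (Z : Omega -> R) : Prop :=
  forall U : set R, measurable U -> G (Z @^-1` U).

Definition adapted B X : Prop :=
  forall s : R, s \in `[0, 1] ->
    rv_measurable_wrt (natural_filtration B s) (X s).

Definition independent_of (P : probability Omega R) (Z : Omega -> R) G : Prop :=
  forall (E : set Omega) (U : set R), G E -> measurable U ->
    (P (E `&` Z @^-1` U) = P E * P (Z @^-1` U))%E.

(* Standard Brownian motion on [0, 1] with respect to its natural filtration
   (Karatzas & Shreve, Definition 2.1.1).
   The second argument of normal_prob is the standard deviation. *)
Definition brownian_motion (P : probability Omega R) B : Prop :=
  [/\ forall t, t \in `[0, 1] -> measurable_fun setT (B t),
      {ae P, forall w, B 0 w = 0},
      forall s t : R, 0 <= s -> s < t -> t <= 1 ->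
        independent_of P (fun w => B t w - B s w) (natural_filtration B s),
      forall s t : R, 0 <= s -> s < t -> t <= 1 ->
        forall U : set R, measurable U ->
          P ((fun w => B t w - B s w) @^-1` U) =
          normal_prob 0 (Num.sqrt (t - s)) U
    & {ae P, forall w, {within `[0, 1], continuous (fun t => B t w)}}].

(* sum_(i < n) xi_i 1_{]t_i, t_(i+1)]} with 0 <= t_0 <= ... <= t_n <= 1 and
   xi_i bounded and F_(t_i)-measurable; grid and weight are irrelevant beyond
   the indices n and n - 1 respectively. *)
Record simple_process B := SimpleProcess {
  sp_size : nat;
  sp_grid : nat -> R;
  sp_weight : nat -> Omega -> R;
  sp_grid_ge0 : 0 <= sp_grid 0%N;
  sp_grid_nd : forall i, (i < sp_size)%N -> sp_grid i <= sp_grid i.+1;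
  sp_grid_le1 : sp_grid sp_size <= 1;
  sp_weight_measurable : forall i, (i < sp_size)%N ->
    rv_measurable_wrt (natural_filtration B (sp_grid i)) (sp_weight i);
  sp_weight_bounded : forall i, (i < sp_size)%N ->
    exists M : R, forall w, `|sp_weight i w| <= M }.

Definition sp_eval B (phi : simple_process B) (s : R) (w : Omega) : R :=
  \sum_(i < sp_size phi)
    sp_weight phi i w * \1_(`]sp_grid phi i, sp_grid phi i.+1]) s.

Definition sp_integral B (phi : simple_process B) (w : Omega) : R :=
  \sum_(i < sp_size phi)
    sp_weight phi i w * (B (sp_grid phi i.+1) w - B (sp_grid phi i) w).

(* E (int_0^1 |H_s|^2 ds) *)
Definition sq_norm (P : probability Omega R) (H : R -> Omega -> R) : \bar R :=
  (\int[P]_w \int[lebesgue_measure]_(s in `[0%R, 1%R]) ((`|H s w| ^+ 2)%R)%:E)%E.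

Definition ito_integrand (P : probability Omega R) B (H : R -> Omega -> R) :=
  [/\ measurable_fun ((`[0, 1] `*` [set: Omega]) : set (measurableTypeR R * Omega))
        (fun p => H p.1 p.2),
      adapted B H
    & (sq_norm P H < +oo)%E].

(* Z is a version of int_0^1 H_s dB(s), which is only determined up to almost
   sure equality (Oksendal, Definitions 3.1.4 and 3.1.6): the L^2 limit of the integrals of simple processes converging
   to H in L^2(P x ds). *)
Definition is_ito_integral (P : probability Omega R) B (H : R -> Omega -> R)
    (Z : Omega -> R) : Prop :=
  [/\ ito_integrand P B H,
      measurable_fun setT Z
    & exists phi : nat -> simple_process B,
        (fun k => sq_norm P (fun s w => H s w - sp_eval (phi k) s w))
          @ \oo --> 0%E /\
        (fun k => 'E_P[fun w => (`|Z w - sp_integral (phi k) w| ^+ 2)%R])%E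
          @ \oo --> 0%E].

Definition modification (P : probability Omega R) X Y : Prop :=
  forall t, t \in `[0, 1] ->
    measurable_fun setT (Y t) /\ {ae P, forall w, Y t w = X t w}.

End processes.

Definition hoelder_on_unit (R : realType) (zeta : R) (f : R -> R) : Prop :=
  exists C : R, forall x y : R, x \in `[0, 1] -> y \in `[0, 1] ->
    `|f x - f y| <= C * `|x - y| `^ zeta.

(* (t - s)_+^(A(s) - 1/2) *)
Definition kernel_power (R : realType) (Omega : Type) (A : R -> Omega -> R)
    (t s : R) (w : Omega) : R :=
  if t <= s then 0 else (t - s) `^ (A s w - 2^-1).

(* Main.v *)
(* Second moments suffice.  Let b = a_low - 1/2.  By the Ito isometry (here as an
   inequality, with an absolute constant), E |X t - X u|^2 is bounded by the
   squared L^2 norm of the difference of the integrands.  For u < t and h = t - u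
   that difference is at most 2 h^b on [u - h, t] and, by the mean value theorem,
   at most h (u - s)^(b - 1) for s < u - h; both parts contribute O(h^(1 + 2 b)),
   uniformly over the paths of A.  Kolmogorov's continuity criterion with
   exponents 2 and 1 + 2 b gives Hoelder paths of every order below b. *)
Require Import Defs.
From HB Require Import structures.
From mathcomp Require Import all_boot all_order all_algebra.
From mathcomp Require Import all_classical all_reals all_analysis.
From mathcomp Require Import measurable_realfun ring lra.
Set Implicit Arguments.
Unset Strict Implicit.
Unset Printing Implicit Defensive.
Import Order.TTheory GRing.Theory Num.Theory.
Import numFieldNormedType.Exports.
Local Open Scope classical_set_scope.
Local Open Scope ring_scope.

(** [X t] is known only as an L^2 limit, so the isometry is proved for simple processes and then
    carried over. Kolmogorov's criterion only sees the power of [t - u], so constants are spent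
    freely: the Gaussian variance [s ^+ 2] is replaced by [6 * s ^+ 2], and Minkowski's inequality
    by the bound of a squared sum by twice the sum of squares. In exchange all integrands in the
    isometry are nonnegative, and Tonelli and monotone convergence replace integrability arguments.
    Two sign conditions make the kernel estimate work. As [b > 0], the moment exponent [1 + 2 b]
    exceeds 1, and the orders obtained, those below half of the excess [2 b], are exactly the
    claimed ones. As [a_up < 1], the far exponent [2 (b - 1)] is below -1, so the far integral is
    governed by its cut-off at distance [h] from [u] and not by the length of the interval. *)

(** * Integration against a density, and second moments of Gaussian laws *)

Section density.
Context d (T : measurableType d) (R : realType).
Variables (mu nu : {measure set T -> \bar R}) (g : T -> R).
Hypotheses (mg : measurable_fun setT g) (g0 : forall x, 0 <= g x).
Hypothesis nuE : forall U, measurable U ->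
  nu U = (\int[mu]_(x in U) (g x)%:E)%E.
Import HBNNSimple.
Local Open Scope ereal_scope.

(** On indicators this is [nuE]; monotone convergence along the simple approximations [h n] does the
    rest. *)
Lemma ge0_integral_density (f : T -> \bar R) :
  measurable_fun [set: T] f -> (forall x, 0 <= f x) ->
  \int[nu]_x f x = \int[mu]_x (f x * (g x)%:E).
Proof.
move=> mf f0; pose h := nnsfun_approx measurableT mf.
have mh n : measurable_fun setT (EFin \o h n) by exact/measurable_EFinP.
have hf x : EFin \o h ^~ x @ \oo --> f x by apply: cvg_nnsfun_approx.
have hfg x : (EFin \o h n) x * (g x)%:E @[n --> \oo] --> f x * (g x)%:E.
  by apply: cvgeZr => //; exact: hf.
have h_nu n : \int[nu]_x (h n x)%:E = \int[mu]_x ((h n x)%:E * (g x)%:E).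
  under eq_integral do rewrite fimfunE -fsumEFin//.
  rewrite ge0_integral_fsum//; last 2 first.
    - by move=> r; exact/measurable_EFinP/measurableT_comp.
    - by move=> r x _; rewrite EFinM nnfun_muleindic_ge0.
  under [RHS]eq_integral => x _.
    rewrite fimfunE -fsumEFin// ge0_mule_fsuml; last first.
      by move=> r; rewrite EFinM nnfun_muleindic_ge0.
    over.
  rewrite ge0_integral_fsum//; last 2 first.
    - move=> r; apply: emeasurable_funM; last exact/measurable_EFinP.
      by exact/measurable_EFinP/measurableT_comp.
    - by move=> r x _; apply: mule_ge0; rewrite ?EFinM ?nnfun_muleindic_ge0// lee_fin.
  apply: eq_fsbigr => r; rewrite inE => -[x _ <-].
  under eq_integral do rewrite EFinM.
  rewrite ge0_integralZl//; [|exact/measurable_EFinP/measurable_indic|by rewrite lee_fin].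
  under [RHS]eq_integral do rewrite EFinM -muleA.
  rewrite ge0_integralZl//; last 3 first.
  - by apply: emeasurable_funM; exact/measurable_EFinP.
  - by move=> y _; rewrite mule_ge0 ?lee_fin.
  - by rewrite lee_fin.
  congr (_ * _); rewrite integral_indic// setIT nuE// integral_mkcond.
  apply: eq_integral => y _; rewrite patchE indicE.
  by case: ifPn => _; rewrite ?mul1e ?mul0e.
transitivity (limn (fun n => \int[nu]_x (h n x)%:E)).
  rewrite -monotone_convergence//.
  - by apply: eq_integral => x _; apply/esym/cvg_lim => //; exact: hf.
  - by move=> n x _; rewrite lee_fin.
  - by move=> x _ a b ab; rewrite lee_fin; exact/lefP/nd_nnsfun_approx.
under eq_fun do rewrite h_nu.
rewrite -monotone_convergence//.
- by apply: eq_integral => x _; apply/cvg_lim => //; exact: hfg.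
- by move=> n; apply: emeasurable_funM => //; exact/measurable_EFinP.
- by move=> n x _; rewrite mule_ge0 ?lee_fin.
- move=> x _ a b ab; rewrite lee_wpmul2r ?lee_fin//.
  exact/lefP/nd_nnsfun_approx.
Qed.

End density.

Section gaussian.
Context (R : realType).
Local Open Scope ereal_scope.
Local Notation mu := (@lebesgue_measure R).

Lemma ge0_integral_lebesgueN (f : R -> \bar R) :
  measurable_fun setT f -> (forall x, 0 <= f x) ->
  \int[mu]_x f (- x)%R = \int[mu]_x f x.
Proof.
move=> mf f0.
rewrite -(@ge0_integral_pushforward _ _ _ _ _
  (-%R : measurableTypeR R -> measurableTypeR R) _ mu setT f)//.
by apply: eq_measure_integral => //= A mA _; exact: lebesgue_measureN.
Qed.

Variable s : R.
Hypothesis s0 : (0 < s)%R.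
Local Notation N := (@normal_prob R 0 s).

Lemma ge0_integral_normal (f : R -> \bar R) :
  measurable_fun setT f -> (forall x, 0 <= f x) ->
  \int[N]_x f x = \int[mu]_x (f x * (normal_pdf 0 s x)%:E).
Proof.
move=> mf f0; apply: ge0_integral_density => //.
- exact: measurable_normal_pdf.
- by move=> x; exact: normal_pdf_ge0.
Qed.

Lemma ge0_integral_normalN (f : R -> \bar R) :
  measurable_fun setT f -> (forall x, 0 <= f x) ->
  \int[N]_x f (- x)%R = \int[N]_x f x.
Proof.
move=> mf f0; rewrite !ge0_integral_normal//; last first.
  by apply: measurableT_comp => //; exact: measurable_funN.
rewrite -[RHS](@ge0_integral_lebesgueN (fun x => f x * (normal_pdf 0 s x)%:E)).
- apply: eq_integral => x _; congr (_ * _%:E).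
  by rewrite normal_pdfE ?gt_eqF// /normal_fun !subr0 sqrrN.
- apply: emeasurable_funM => //.
  by apply/measurable_EFinP; exact: measurable_normal_pdf.
- by move=> x; rewrite mule_ge0// lee_fin normal_pdf_ge0.
Qed.

(* [z <= expR z] absorbs the factor [y ^+ 2] when the standard deviation is
   doubled. *)
Lemma sqr_normal_pdf_le (y : R) :
  (y ^+ 2 * normal_pdf 0 s y <= 6 * s ^+ 2 * normal_pdf 0 (2 * s) y)%R.
Proof.
have s2 : (0 < s ^+ 2)%R by rewrite exprn_gt0.
have peakE : (normal_peak s = 2 * normal_peak (2 * s))%R.
  rewrite /normal_peak.
  have -> : ((2 * s) ^+ 2 * pi *+ 2 = 2 ^+ 2 * (s ^+ 2 * pi *+ 2))%R by ring.
  rewrite sqrtrM ?sqr_ge0// sqrtr_sqr ger0_norm// invfM.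
  by rewrite mulrA divff ?mul1r// pnatr_eq0.
rewrite !normal_pdfE ?gt_eqF ?mulr_gt0// peakE /normal_fun !subr0.
set p := normal_peak _; have p0 : (0 <= p)%R by exact: normal_peak_ge0.
set z := (y ^+ 2 / s ^+ 2)%R.
have z0 : (0 <= z)%R by rewrite divr_ge0 ?sqr_ge0.
(* The term [- z / 8] is the exponent for deviation [2 * s]; the other one leaves
   [z / expR (3 / 8 * z)], at most [8 / 3] and hence 3. With the factor 2 between the two peaks this
   gives the constant 6. *)
have -> : (- y ^+ 2 / (s ^+ 2 *+ 2) = - (3 / 8 * z) - z / 8)%R.
  by rewrite /z; field; rewrite gt_eqF.
have -> : (- y ^+ 2 / ((2 * s) ^+ 2 *+ 2) = - z / 8)%R.
  by rewrite /z; field; rewrite gt_eqF.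
have -> : (y ^+ 2 = z * s ^+ 2)%R by rewrite /z divfK// gt_eqF.
rewrite expRD (expRN (3 / 8 * z)) -(mulNr z).
have h : (z / expR (3 / 8 * z) <= 8 / 3)%R.
  rewrite ler_pdivrMr ?expR_gt0//.
  have := expR_ge1Dx (3 / 8 * z); lra.
rewrite [leLHS](_ : _ = (z / expR (3 / 8 * z)) *
  (2 * s ^+ 2 * p * expR (- z / 8)))%R; last first.
  by ring.
rewrite [leRHS](_ : _ = 3 * (2 * s ^+ 2 * p * expR (- z / 8)))%R; last by ring.
apply: ler_wpM2r; last lra.
by rewrite !mulr_ge0// ?expR_ge0// ltW.
Qed.

(** The exact value is [s ^+ 2]. Domination by a multiple of the density of deviation [2 * s], which
    has mass one, avoids integration by parts. *)
Lemma normal_sqr_le : \int[N]_y (y ^+ 2)%:E <= (6 * s ^+ 2)%:E.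
Proof.
have msq : measurable_fun [set: R] (fun y : R => (y ^+ 2)%:E).
  by apply/measurable_EFinP; exact: measurable_funX.
rewrite ge0_integral_normal//; last by move=> x; rewrite lee_fin sqr_ge0.
apply: (@le_trans _ _ (\int[mu]_y ((6 * s ^+ 2)%:E * (normal_pdf 0 (2 * s) y)%:E))).
  apply: ge0_le_integral => //.
  - by move=> x _; rewrite lee_fin mulr_ge0 ?sqr_ge0 ?normal_pdf_ge0.
  - apply: emeasurable_funM => //.
    by apply/measurable_EFinP; exact: measurable_normal_pdf.
  - apply: emeasurable_funM => //.
    by apply/measurable_EFinP; exact: measurable_normal_pdf.
  - by move=> x _; rewrite lee_fin sqr_normal_pdf_le.
rewrite ge0_integralZl//.
- by rewrite integral_normal_pdf mule1.
- by apply/measurable_EFinP; exact: measurable_normal_pdf.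
- by move=> x _; rewrite lee_fin normal_pdf_ge0.
- by rewrite lee_fin mulr_ge0// sqr_ge0.
Qed.

(* The cross term disappears by averaging over [y] and [- y], so that no
   integrability has to be checked. *)
Lemma normal_affine_sqr_le (a b : R) :
  \int[N]_y ((a + b * y) ^+ 2)%:E <= (a ^+ 2 + b ^+ 2 * (6 * s ^+ 2))%:E.
Proof.
have msq c : measurable_fun [set: R] (fun y : R => ((a + c * y) ^+ 2)%:E).
  apply/measurable_EFinP; apply: measurable_funX; apply: measurable_funD => //.
have sq0 c x : 0 <= ((a + c * x) ^+ 2)%:E by rewrite lee_fin sqr_ge0.
have opp : \int[N]_y ((a + b * y) ^+ 2)%:E = \int[N]_y ((a + (- b) * y) ^+ 2)%:E.
  rewrite -ge0_integral_normalN//.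
  by apply: eq_integral => y _; rewrite mulrN mulNr.
have dbl : 2%:E * \int[N]_y ((a + b * y) ^+ 2)%:E =
    \int[N]_y ((2 * a ^+ 2)%:E + (2 * b ^+ 2)%:E * (y ^+ 2)%:E).
  rewrite mule_natl mule2n {2}opp -ge0_integralD//.
    by apply: eq_integral => y _; rewrite -EFinM -!EFinD; congr EFin; ring.
  - exact: msq.
  - exact: msq.
rewrite -(@lee_pmul2l R 2%:E)// dbl ge0_integralD//; last 3 first.
- by move=> y _; rewrite lee_fin mulr_ge0// sqr_ge0.
- move=> y _; rewrite -EFinM lee_fin; apply: mulr_ge0; last exact: (@sqr_ge0 R).
  by rewrite mulr_ge0 ?sqr_ge0.
- apply: emeasurable_funM => //.
  by apply/measurable_EFinP; exact: measurable_funX.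
have -> : \int[N]__ (2 * a ^+ 2)%:E = (2 * a ^+ 2)%:E.
  by rewrite integral_cst// [X in _ * X](@probability_setT _ _ _ N) mule1.
rewrite ge0_integralZl//; last 3 first.
- by apply/measurable_EFinP; exact: measurable_funX.
- by move=> y _; rewrite lee_fin sqr_ge0.
- by rewrite lee_fin mulr_ge0// sqr_ge0.
rewrite -EFinM mulrDr EFinD leeD2l// (mulrA 2%R (b ^+ 2)%R) (EFinM (2 * b ^+ 2)%R).
by rewrite lee_wpmul2l ?normal_sqr_le// lee_fin mulr_ge0// sqr_ge0.
Qed.

End gaussian.

(** * Independence, and the second moment of one step of a stochastic integral *)

Section independence.
Context d (Omega : measurableType d) (R : realType).
Variable P : probability Omega R.
Local Open Scope ereal_scope.

(** The factorization on rectangles identifies the joint law with the product of the law of [V] and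
    [N], by uniqueness of product measures; Tonelli then iterates the integral. *)
Lemma ge0_integral_independent d1 d2 (T1 : measurableType d1)
    (T2 : measurableType d2) (V : {mfun Omega >-> T1}) (Z : {mfun Omega >-> T2})
    (N : probability T2 R) (f : T1 * T2 -> \bar R) :
  (forall U U', measurable U -> measurable U' ->
    P (V @^-1` U `&` Z @^-1` U') = P (V @^-1` U) * N U') ->
  measurable_fun setT f -> (forall x, 0 <= f x) ->
  \int[P]_w f (V w, Z w) = \int[P]_w \int[N]_y f (V w, y).
Proof.
move=> VZ mf f0.
have mVZ : measurable_fun setT (fun w => (V w, Z w)) by exact: measurable_fun_pair.
rewrite -(ge0_integral_distribution V (f := fubini_F N f)); last 2 first.
- exact: measurable_fun_fubini_tonelli_F.
- by move=> y; apply: integral_ge0.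
rewrite -fubini_tonelli1//.
rewrite -(@ge0_integral_pushforward _ _ _ _ _ _ mVZ P setT f)//.
apply: eq_measure_integral => A mA _; apply/esym.
apply: product_measure_unique mA => U U' mU mU'.
exact: VZ.
Qed.

Variables (G : set (set Omega)).
Hypothesis GP : <<s G>> `<=` measurable.
Local Notation GT := (g_sigma_algebraType G).

Lemma measurable_fun_sub_sigma_algebra d' (T : measurableType d') (S : Omega -> T) :
  measurable_fun [set: GT] (S : GT -> T) -> measurable_fun setT S.
Proof.
move=> mS _ U mU; rewrite setTI; apply: GP.
by have := mS measurableT U mU; rewrite setTI.
Qed.

(** [S] is meant as the integral up to some time, [eta] as the integrand on the next step and [Z] as
    the Brownian increment. Freezing the pair [(S, eta)] and integrating over [Z] first reduces the
    claim to [normal_affine_sqr_le]. *)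
Lemma independent_gaussian_sqr_le (S eta Z : Omega -> R) (s : R) :
  (0 < s)%R ->
  measurable_fun [set: GT] (S : GT -> R) ->
  measurable_fun [set: GT] (eta : GT -> R) ->
  measurable_fun setT Z ->
  independent_of P Z <<s G>> ->
  (forall U, measurable U -> P (Z @^-1` U) = normal_prob 0 s U) ->
  \int[P]_w ((S w + eta w * Z w) ^+ 2)%:E <=
  \int[P]_w ((S w) ^+ 2)%:E + (6 * s ^+ 2)%:E * \int[P]_w ((eta w) ^+ 2)%:E.
Proof.
move=> s0 mS meta mZ indep Zlaw.
have mV' : measurable_fun [set: GT] ((fun w => (S w, eta w)) : GT -> R * R).
  exact: measurable_fun_pair.
have mV : measurable_fun setT (fun w => (S w, eta w)).
  exact: measurable_fun_sub_sigma_algebra.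
pose V : {mfun Omega >-> (R * R)%type} := HB.pack (fun w => (S w, eta w))
  (isMeasurableFun.Build _ _ _ _ _ mV).
have mZ' : measurable_fun setT (Z : Omega -> measurableTypeR R) by exact: mZ.
pose Z' : {mfun Omega >-> measurableTypeR R} :=
  HB.pack (Z : Omega -> measurableTypeR R) (isMeasurableFun.Build _ _ _ _ _ mZ').
pose f (x : (R * R) * measurableTypeR R) : \bar R := ((x.1.1 + x.1.2 * x.2) ^+ 2)%:E.
have mf : measurable_fun setT f.
  apply/measurable_EFinP/measurable_funX/measurable_funD.
    by apply: measurableT_comp => //; exact: measurable_fst.
  apply: measurable_funM => //.
  by apply: measurableT_comp => //; exact: measurable_snd.
have f0 x : 0 <= f x by rewrite lee_fin sqr_ge0.
have := @ge0_integral_independent _ _ _ _ V Z' (normal_prob 0 s) f _ mf f0.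
rewrite /f/= => ->; last first.
  move=> U U' mU mU'; rewrite -Zlaw//; apply: indep => //.
  by have := mV' measurableT U mU; rewrite setTI.
have mS2 : measurable_fun setT (fun w => ((S w) ^+ 2)%:E).
  apply/measurable_EFinP/measurable_funX.
  exact: measurable_fun_sub_sigma_algebra.
have meta2 : measurable_fun setT (fun w => ((eta w) ^+ 2)%:E).
  apply/measurable_EFinP/measurable_funX.
  exact: measurable_fun_sub_sigma_algebra.
rewrite -ge0_integralZl//; last 2 first.
- by move=> w _; rewrite lee_fin sqr_ge0.
- by rewrite lee_fin mulr_ge0// sqr_ge0.
rewrite -ge0_integralD//; last 3 first.
- by move=> w _; rewrite lee_fin sqr_ge0.
- move=> w _; rewrite mule_ge0// lee_fin ?sqr_ge0//.
  by apply: mulr_ge0 => //; exact: sqr_ge0.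
- exact: emeasurable_funM.
apply: ge0_le_integral => //.
- by move=> w _; apply: integral_ge0 => y _; rewrite lee_fin sqr_ge0.
- apply: (measurableT_comp (measurable_fun_fubini_tonelli_F f mf f0) mV).
- apply: emeasurable_funD => //; exact: emeasurable_funM.
- move=> w _; rewrite -EFinM -EFinD [X in (_ + X)%R]mulrC.
  exact: normal_affine_sqr_le.
Qed.

End independence.

(** Replaces the triangle inequality of L^2 at the price of a factor 2: no square roots, and
    infinite values are allowed. *)
Lemma integral_sqr_leD d (T : measurableType d) (R : realType)
    (mu : {measure set T -> \bar R}) (D : set T) (f g : T -> R) :
  measurable D -> measurable_fun D f -> measurable_fun D g ->
  (\int[mu]_(x in D) (`|f x + g x| ^+ 2)%:E <=
   2%:E * \int[mu]_(x in D) (`|f x| ^+ 2)%:E +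
   2%:E * \int[mu]_(x in D) (`|g x| ^+ 2)%:E)%E.
Proof.
move=> mD mf mg.
have msq (h : T -> R) : measurable_fun D h -> measurable_fun D (fun x => (`|h x| ^+ 2)%:E).
  by move=> mh; apply/measurable_EFinP/measurable_funX/measurableT_comp.
have sq0 h (x : T) : (0 <= (`|h x : R| ^+ 2)%:E)%E by rewrite lee_fin sqr_ge0.
rewrite -!ge0_integralZl//; [|exact: msq..].
have m2 (h : T -> R) : measurable_fun D h ->
    measurable_fun D (fun x => 2%:E * (`|h x| ^+ 2)%:E)%E.
  by move=> mh; apply: emeasurable_funM => //; exact: msq.
rewrite -ge0_integralD//; [|exact: m2..].
apply: ge0_le_integral => //.
- exact/msq/measurable_funD.
- by apply: emeasurable_funD; exact: m2.
- move=> x _; rewrite -!EFinM -EFinD lee_fin !real_normK ?num_real//.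
  by have := sqr_ge0 (f x - g x); nra.
Qed.

(** * Squared norms of processes over a set of times *)

Section sq_norm_on.
Context d (Omega : measurableType d) (R : realType).
Variable P : probability Omega R.
Local Open Scope ereal_scope.
Implicit Types (D : set R) (H : R -> Omega -> R).

(** [sq_norm] is the case of the unit interval; a variable time set lets the norm be cut at the
    endpoints of a simple process. *)
Definition sq_norm_on D H : \bar R :=
  \int[P]_w \int[lebesgue_measure]_(s in D) ((`|H s w| ^+ 2)%R)%:E.

Definition jointly_measurable_on D H :=
  measurable_fun ((D `*` [set: Omega]) : set (measurableTypeR R * Omega))
    (fun p => H p.1 p.2).

Let measurableXT D : measurable D ->
  measurable ((D `*` [set: Omega]) : set (measurableTypeR R * Omega)).
Proof. by move=> mD; apply: measurableX. Qed.

Let sq_patch D H : measurableTypeR R * Omega -> \bar R :=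
  (fun p => ((`|H p.1 p.2| ^+ 2)%R)%:E) \_ (D `*` [set: Omega]).

Let measurable_sq_patch D H : measurable D -> jointly_measurable_on D H ->
  measurable_fun setT (sq_patch D H).
Proof.
move=> mD mH; apply/(measurable_restrictT _ (measurableXT mD)).
by apply/measurable_EFinP/measurable_funX/measurableT_comp.
Qed.

Let sq_patch_ge0 D H x : 0 <= sq_patch D H x.
Proof. by rewrite /sq_patch patchE; case: ifPn => // _; rewrite lee_fin sqr_ge0. Qed.

Let sq_patch_section D H w :
  \int[lebesgue_measure]_(s in D) ((`|H s w| ^+ 2)%R)%:E =
  fubini_G lebesgue_measure (sq_patch D H) w.
Proof.
rewrite /fubini_G [LHS]integral_mkcond; apply: eq_integral => s _.
by rewrite /sq_patch !patchE in_setX in_setT andbT.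
Qed.

Lemma measurable_sq_section D H : measurable D -> jointly_measurable_on D H ->
  measurable_fun setT
    (fun w => \int[lebesgue_measure]_(s in D) ((`|H s w| ^+ 2)%R)%:E).
Proof.
move=> mD mH; under eq_fun do rewrite sq_patch_section.
by apply: measurable_fun_fubini_tonelli_G => //; exact: measurable_sq_patch.
Qed.

Lemma jointly_measurable_section D H w : measurable D ->
  jointly_measurable_on D H -> measurable_fun D (H ^~ w).
Proof.
move=> mD mH.
apply: (measurable_comp (F := D `*` [set: Omega])
  (g := fun s : measurableTypeR R => (s, w)) _ _ mH).
- exact: measurableXT.
- by move=> _ [s Ds <-].
- by apply: measurable_funTS; exact: measurable_fun_pair.
Qed.

(** By Tonelli. As a single integral over the product space, the squared norm inherits additivity
    and [integral_sqr_leD] from general measure theory. *)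
Lemma sq_norm_onE D H : measurable D -> jointly_measurable_on D H ->
  sq_norm_on D H =
  \int[(lebesgue_measure : set (measurableTypeR R) -> \bar R) \x P]_(p in
    (D `*` [set: Omega]) : set (measurableTypeR R * Omega))
     ((`|H p.1 p.2| ^+ 2)%R)%:E.
Proof.
move=> mD mH; rewrite integral_mkcond -/(sq_patch D H).
rewrite (fubini_tonelli2 _ (measurable_sq_patch mD mH))//.
by apply: eq_integral => w _; rewrite sq_patch_section.
Qed.

Lemma sq_norm_on_leD D H1 H2 : measurable D ->
  jointly_measurable_on D H1 -> jointly_measurable_on D H2 ->
  sq_norm_on D (fun s w => H1 s w + H2 s w)%R <=
  2%:E * sq_norm_on D H1 + 2%:E * sq_norm_on D H2.
Proof.
move=> mD mH1 mH2; rewrite !sq_norm_onE//; last exact: measurable_funD.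
by apply: integral_sqr_leD => //; exact: measurableXT.
Qed.

Lemma sq_norm_on_setU D D' H : measurable D -> measurable D' ->
  [disjoint D & D'] -> jointly_measurable_on (D `|` D') H ->
  sq_norm_on (D `|` D') H = sq_norm_on D H + sq_norm_on D' H.
Proof.
move=> mD mD' DD' mH.
have mU : measurable (D `|` D') by exact: measurableU.
rewrite !sq_norm_onE//; last 2 first.
- apply: measurable_funS mH; first exact: measurableXT.
  by move=> -[s w] /= [D's _]; split => //; right.
- apply: measurable_funS mH; first exact: measurableXT.
  by move=> -[s w] /= [Ds _]; split => //; left.
have -> : (D `|` D') `*` [set: Omega] =
    (D `*` [set: Omega]) `|` (D' `*` [set: Omega]).
  apply/seteqP; split => -[s w] /=; first by case=> -[]; [left|right].
  by case=> -[]; split => //; [left|right].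
have mf : measurable_fun ((D `*` [set: Omega]) `|` (D' `*` [set: Omega]))
    (fun p : measurableTypeR R * Omega => ((`|H p.1 p.2| ^+ 2)%R)%:E).
  apply/measurable_EFinP/measurable_funX/measurableT_comp => //.
  apply: measurable_funS mH; first exact: measurableXT.
  by move=> -[s w] /=; case=> -[]; split => //; [left|right].
apply: (ge0_integral_setU _ (measurableXT mD) (measurableXT mD') mf).
- by move=> x _; rewrite lee_fin sqr_ge0.
- apply/disj_setPS => -[s w] /= [[Ds _] [D's _]].
  by move/disj_setPS : DD' => /(_ s); apply.
Qed.

End sq_norm_on.

(** Applied to the list of all endpoints, this yields [u] such that none of them lies strictly
    between [u] and [v]. *)
Lemma max_below (R : realDomainType) (L : seq R) (v : R) :
  (exists2 p, p \in L & p < v) ->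
  exists2 u, (u \in L) && (u < v) & forall p, p \in L -> p < v -> p <= u.
Proof.
move=> [p pL pv]; exists (\big[Num.max/p]_(q <- L | q < v) q).
  rewrite big_seq_cond; elim/big_ind: _ => [|x y xL yL|q /andP[-> ->]//].
    by rewrite pL pv.
  by rewrite /Num.max; case: ifP.
by move=> q qL qv; exact: (@le_bigmax_seq _ _ _ _ p q _ id qL qv).
Qed.

(** * The isometry inequality for elementary integrands *)

Section elementary_integrals.
Context d (Omega : measurableType d) (R : realType).
Variables (P : probability Omega R) (B : R -> Omega -> R).
Hypothesis B_brownian : brownian_motion P B.

Let gen (s : R) : set (set Omega) :=
  [set E | exists2 u : R, u \in `[0, s] &
    exists2 U : set R, measurable U & E = B u @^-1` U].

Let FT s := g_sigma_algebraType (gen s).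

Let BM_measurable t : 0 <= t <= 1 -> measurable_fun setT (B t).
Proof. by move=> t01; case: B_brownian => + _ _ _ _; apply; rewrite in_itv. Qed.

Let gen_sub s : gen s `<=` natural_filtration B s.
Proof. exact: sub_sigma_algebra. Qed.

Lemma natural_filtration_sub s : s <= 1 ->
  natural_filtration B s `<=` measurable.
Proof.
move=> s1; apply: smallest_sub; first exact: sigma_algebra_measurable.
move=> _ [u /[!in_itv]/= /andP[u0 us] [U mU ->]].
rewrite -[_ @^-1` _]setTI; apply: BM_measurable => //.
by rewrite u0 (le_trans us).
Qed.

Lemma natural_filtration_mono s t : s <= t ->
  natural_filtration B s `<=` natural_filtration B t.
Proof.
move=> st; apply: smallest_sub; first exact: smallest_sigma_algebra.
move=> _ [u /[!in_itv]/= /andP[u0 us] [U mU ->]]; apply: gen_sub.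
by exists u; [rewrite in_itv/= u0 (le_trans us)|exists U].
Qed.

Let rv_measurableP s (Z : Omega -> R) :
  rv_measurable_wrt (natural_filtration B s) Z <->
  measurable_fun [set: FT s] (Z : FT s -> R).
Proof.
split=> [mZ _ U mU|mZ U mU]; first by rewrite setTI; exact: mZ.
by have := mZ measurableT U mU; rewrite setTI.
Qed.

Let rv_measurable_le s t (Z : Omega -> R) : s <= t ->
  rv_measurable_wrt (natural_filtration B s) Z ->
  rv_measurable_wrt (natural_filtration B t) Z.
Proof. by move=> st mZ U mU; apply: (natural_filtration_mono st); exact: mZ. Qed.

Let rv_measurable_brownian s u : 0 <= u <= s ->
  rv_measurable_wrt (natural_filtration B s) (B u).
Proof.
move=> us U mU; apply: gen_sub.
by exists u; [rewrite in_itv|exists U].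
Qed.

Lemma rv_measurable_measurable s (Z : Omega -> R) : s <= 1 ->
  rv_measurable_wrt (natural_filtration B s) Z -> measurable_fun setT Z.
Proof.
by move=> s1 mZ _ U mU; rewrite setTI; apply: natural_filtration_sub (mZ _ mU).
Qed.

(* The intervals [`]a i, b i]] may overlap and come in any order, so that the
   difference of two simple processes has this form without refining grids. *)
Variables (I : finType) (a b : I -> R) (xi : I -> Omega -> R).
Hypotheses (a_ge0 : forall i, 0 <= a i) (ab : forall i, a i <= b i).
Hypothesis b_le1 : forall i, b i <= 1.
Hypothesis xi_measurable : forall i,
  rv_measurable_wrt (natural_filtration B (a i)) (xi i).

Definition elem_eval (s : R) (w : Omega) : R :=
  \sum_i xi i w * \1_(`]a i, b i]) s.

(** The minima with [v] stop the Brownian motion at [v], which gives the integral over [[0, v]] and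
    a quantity to induct on; at [v = 1] they disappear because of [b_le1]. *)
Definition elem_integral (v : R) (w : Omega) : R :=
  \sum_i xi i w * (B (Num.min (b i) v) w - B (Num.min (a i) v) w).

Lemma elem_eval_jointly_measurable D : measurable D ->
  jointly_measurable_on D elem_eval.
Proof.
move=> mD; apply: measurable_funTS.
apply: measurable_sum => i; apply: measurable_funM.
  apply: (measurableT_comp (f := xi i)) => //.
  exact: (@rv_measurable_measurable _ _ (le_trans (ab i) (b_le1 i)) (@xi_measurable i)).
apply: (measurableT_comp (f := \1_(`]a i, b i]) : measurableTypeR R -> R)) => //.
Qed.

(** A term whose interval starts at or after [u] vanishes, so only weights already known at time [u]
    remain. *)
Lemma elem_integral_adapted u : 0 <= u <= 1 ->
  rv_measurable_wrt (natural_filtration B u) (elem_integral u).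
Proof.
move=> /andP[u0 u1]; apply/rv_measurableP; apply: measurable_sum => i.
have [ua|au] := leP u (a i).
  rewrite min_r ?(le_trans ua)// ?min_r//.
  by under eq_fun do rewrite subrr mulr0; exact: measurable_cst.
apply: measurable_funM.
  by apply/rv_measurableP; exact: (@rv_measurable_le _ _ _ (ltW au) (@xi_measurable i)).
have mB r : 0 <= r <= u -> measurable_fun [set: FT u] (B r : FT u -> R).
  by move=> ru; exact: (rv_measurableP _ _).1 (@rv_measurable_brownian _ _ ru).
apply: measurable_funB; apply: mB.
  by rewrite ge_min lexx orbT le_min u0 (le_trans _ (ab i)).
by rewrite a_ge0 ltW.
Qed.

Section step.
Variables u v : R.
Hypotheses (u0 : 0 <= u) (uv : u < v) (v1 : v <= 1).
Hypothesis a_gap : forall i, a i < v -> a i <= u.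
Hypothesis b_gap : forall i, b i < v -> b i <= u.

Let indicE_step i s : u < s -> s <= v ->
  \1_(`]a i, b i]) s = (\1_(`]a i, b i]) v : R).
Proof.
move=> us sv; rewrite !indicE; congr (_%:R); congr nat_of_bool.
apply/idP/idP; rewrite !inE/= !in_itv/= => /andP[aisv svbi]; apply/andP; split.
- exact: lt_le_trans sv.
- by rewrite leNgt; apply/negP => /b_gap bu; move: us; rewrite ltNge (le_trans svbi).
- exact: le_lt_trans (a_gap aisv) us.
- exact: le_trans svbi.
Qed.

Lemma elem_eval_step s w : u < s -> s <= v -> elem_eval s w = elem_eval v w.
Proof. by move=> us sv; apply: eq_bigr => i _; rewrite indicE_step. Qed.

(** An interval []a i, b i]] that contains [v] starts before [v], hence by [a_gap] no later than
    [u]. This is where the intervals being open on the left matters. *)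
Lemma elem_eval_previsible :
  rv_measurable_wrt (natural_filtration B u) (elem_eval v).
Proof.
apply/rv_measurableP; apply: measurable_sum => i; rewrite indicE.
have [|_] := boolP (v \in `]a i, b i]%classic); last first.
  by under eq_fun do rewrite mulr0; exact: measurable_cst.
rewrite inE/= in_itv/= => /andP[av _]; under eq_fun do rewrite mulr1.
by apply/rv_measurableP; exact: (@rv_measurable_le _ _ _ (@a_gap i av) (@xi_measurable i)).
Qed.

Lemma elem_integral_step w :
  elem_integral v w = elem_integral u w + elem_eval v w * (B v w - B u w).
Proof.
rewrite /elem_eval mulr_suml -big_split/=; apply: eq_bigr => i _.
rewrite -mulrA -mulrDr; congr (_ * _); rewrite indicE.
have [va|] := boolP (v <= a i).
  have vb := le_trans va (ab i).
  have ua := le_trans (ltW uv) va; have ub := le_trans (ltW uv) vb.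
  rewrite !min_r// !subrr add0r memNset ?mul0r//=.
  by rewrite in_itv/= ltNge va.
rewrite -ltNge => av; have au := a_gap av.
have [vb|] := boolP (v <= b i).
  rewrite mem_set/= ?in_itv/= ?av// mul1r.
  rewrite (min_r vb) (min_l (ltW av)) (min_l au) min_r ?(le_trans (ltW uv))//.
  by ring.
rewrite -ltNge => bv; have bu := b_gap bv.
rewrite (min_l (ltW bv)) (min_l (ltW av)) (min_l au) (min_l bu) memNset/=.
  by rewrite mul0r addr0.
by rewrite in_itv/= leNgt bv andbF.
Qed.

Lemma sq_norm_on_step :
  sq_norm_on P `]u, v] elem_eval =
  ((v - u)%:E * \int[P]_w ((elem_eval v w) ^+ 2)%:E)%E.
Proof.
have meta : measurable_fun setT (elem_eval v).
  by apply: rv_measurable_measurable elem_eval_previsible; exact: le_trans (ltW uv) v1.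
rewrite -ge0_integralZl//; last 3 first.
- exact/measurable_EFinP/measurable_funX.
- by move=> w _; rewrite lee_fin sqr_ge0.
- by rewrite lee_fin subr_ge0 ltW.
apply: eq_integral => w _.
rewrite (eq_integral (cst ((elem_eval v w) ^+ 2)%:E)); last first.
  move=> s; rewrite inE/= in_itv/= => /andP[us sv].
  by rewrite elem_eval_step// real_normK ?num_real.
rewrite integral_cst//= lebesgue_measure_itv/= lte_fin uv muleC.
by rewrite EFinB.
Qed.

(** The increment of [B] over []u, v]] is independent of F_u, which knows both the integral up to
    [u] and the integrand on the step. Its variance [v - u] is the length of the step in the time
    integral. *)
Lemma elem_integral_sqr_step :
  (\int[P]_w ((elem_integral v w) ^+ 2)%:E <=
   \int[P]_w ((elem_integral u w) ^+ 2)%:E +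
   6%:E * sq_norm_on P `]u, v] elem_eval)%E.
Proof.
have u1 : u <= 1 by exact: le_trans (ltW uv) v1.
case: B_brownian => _ _ indep law _.
under eq_integral do rewrite elem_integral_step.
have vu0 : 0 < Num.sqrt (v - u) by rewrite sqrtr_gt0 subr_gt0.
have := @independent_gaussian_sqr_le _ _ _ P _ (natural_filtration_sub u1)
  (elem_integral u) (elem_eval v) (fun w => B v w - B u w) _ vu0.
rewrite sqr_sqrtr ?subr_ge0 ?(ltW uv)// sq_norm_on_step EFinM -muleA; apply.
- by apply/rv_measurableP; apply: elem_integral_adapted; apply/andP; split.
- exact: (rv_measurableP _ _).1 elem_eval_previsible.
- apply: measurable_funB; apply: BM_measurable; first by rewrite v1 (le_trans u0 (ltW uv)).
  by rewrite u0 u1.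
- exact: indep.
- by move=> U mU; apply: law.
Qed.

End step.


(* Induction on the number of endpoints below [v]: on [`]u, v]], where [u] is the
   largest of them, the integrand is constant in time and F_u-measurable. *)
Lemma elem_integral_sqr_le_itv (v : R) : 0 <= v <= 1 ->
  (\int[P]_w ((elem_integral v w) ^+ 2)%:E <=
   6%:E * sq_norm_on P `[0%R, v] elem_eval)%E.
Proof.
(* The point 0 is added so that every [v > 0] has some point below it, as [max_below] requires. *)
move=> /andP[]; pose pts := 0 :: codom a ++ codom b.
have aP i : a i \in pts by rewrite inE mem_cat codom_f orbT.
have bP i : b i \in pts by rewrite inE mem_cat codom_f !orbT.
have pts_ge0 p : p \in pts -> 0 <= p.
  rewrite inE mem_cat => /or3P[/eqP->//|/codomP[i ->]//|/codomP[i ->]].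
  exact: le_trans (ab i).
have [n] := ubnP (count (fun p => p < v) pts).
elim: n v => // n IH v; rewrite ltnS => cv; rewrite le_eqVlt => /predU1P[<- _|v0 v1].
  rewrite integral0_eq ?mule_ge0 ?integral_ge0// => w _.
    by apply: integral_ge0 => s _; rewrite lee_fin sqr_ge0.
  rewrite /elem_integral big1 ?expr0n// => i _.
  by rewrite !min_r ?subrr ?mulr0// (le_trans (a_ge0 i)).
have [|u /andP[uP uv] umax] := max_below (L := pts) (v := v).
  by exists 0 => //; rewrite inE eqxx.
have u0 := pts_ge0 _ uP.
have -> : `[0, v]%classic = `[0, u]%classic `|` `]u, v]%classic.
  by rewrite -itv_bndbnd_setU// bnd_simp ?ltW.
rewrite sq_norm_on_setU//; last 2 first.
- apply/disj_setPS => s [] /=; rewrite !in_itv/= => /andP[_ su] /andP[us _].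
  by move: su; rewrite leNgt us.
- by apply: elem_eval_jointly_measurable; exact: measurableU.
rewrite muleDr ?ge0_adde_def ?inE//; last 2 first.
- by apply: integral_ge0 => w _; apply: integral_ge0 => s _; rewrite lee_fin sqr_ge0.
- by apply: integral_ge0 => w _; apply: integral_ge0 => s _; rewrite lee_fin sqr_ge0.
apply: (le_trans (elem_integral_sqr_step u0 uv v1 _ _)).
- by move=> i; exact: umax.
- by move=> i; exact: umax.
apply: leeD => //; apply: IH => //; last exact: le_trans (ltW uv) v1.
(* The count drops strictly: [u] itself lies below [v] but not below [u]. *)
apply: leq_trans cv; apply: (@leq_trans (count (fun p => (p < u)%R) pts + count (pred1 u) pts)%N).
  by rewrite -addn1 leq_add2l -has_count has_pred1.
rewrite -count_predUI [X in (_ + X)%N](_ : _ = 0%N) ?addn0.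
  by apply: sub_count => p /= /orP[/lt_trans->//|/eqP->].
rewrite (eq_count (a2 := pred0)) ?count_pred0// => p /=.
by case: eqP => [->|_]; rewrite ?ltxx ?andbF.
Qed.

Lemma elem_integral_sqr_le :
  (\int[P]_w ((\sum_i xi i w * (B (b i) w - B (a i) w)) ^+ 2)%:E <=
   6%:E * sq_norm_on P `[0%R, 1%R] elem_eval)%E.
Proof.
under eq_integral => w _.
  under eq_bigr => i _.
    rewrite -{1}(min_l (b_le1 i)) -{1}(min_l (le_trans (ab i) (b_le1 i))).
    over.
  over.
by apply: elem_integral_sqr_le_itv; rewrite ler01 lexx.
Qed.

End elementary_integrals.

(** * From simple processes to Itô integrals *)

Section ito_isometry.
Context d (Omega : measurableType d) (R : realType).
Variables (P : probability Omega R) (B : R -> Omega -> R).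
Hypothesis B_brownian : brownian_motion P B.
Implicit Types phi psi : simple_process B.

Lemma sp_grid_itv phi i : (i <= sp_size phi)%N -> 0 <= sp_grid phi i <= 1.
Proof.
move=> ni; have le_grid j k : (j <= k <= sp_size phi)%N ->
    sp_grid phi j <= sp_grid phi k.
  move=> /andP[]; elim: k => [|k IH]; first by rewrite leqn0 => /eqP->.
  rewrite leq_eqVlt => /predU1P[->//|jk kn].
  by rewrite (le_trans (IH jk (ltnW kn)))// sp_grid_nd.
by rewrite (le_trans (sp_grid_ge0 phi)) ?(le_trans _ (sp_grid_le1 phi)) ?le_grid//= leqnn ni.
Qed.

Let grid_nd phi (i : 'I_(sp_size phi)) : sp_grid phi i <= sp_grid phi i.+1.
Proof. exact: sp_grid_nd. Qed.

Let grid_ge0 phi (i : 'I_(sp_size phi)) : 0 <= sp_grid phi i.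
Proof. by have /andP[] := sp_grid_itv (ltnW (ltn_ord i)). Qed.

Let grid_le1 phi (i : 'I_(sp_size phi)) : sp_grid phi i.+1 <= 1.
Proof. by have /andP[] := sp_grid_itv (ltn_ord i). Qed.

Let weight_measurable phi (i : 'I_(sp_size phi)) :
  rv_measurable_wrt (natural_filtration B (sp_grid phi i)) (sp_weight phi i).
Proof. exact: sp_weight_measurable. Qed.

Lemma sp_eval_jointly_measurable phi :
  jointly_measurable_on `[0, 1] (sp_eval phi).
Proof.
exact: (elem_eval_jointly_measurable B_brownian (@grid_nd phi) (@grid_le1 phi)
  (@weight_measurable phi)).
Qed.

Lemma measurable_sp_integral phi : measurable_fun setT (sp_integral phi).
Proof.
case: B_brownian => mB _ _ _ _; apply: measurable_sum => i.
apply: measurable_funM; last first.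
  by apply: measurable_funB; apply: mB; rewrite in_itv/=;
    apply: sp_grid_itv => //; exact: ltnW.
apply: (rv_measurable_measurable B_brownian _ (@weight_measurable phi i)).
exact: le_trans (@grid_nd phi i) (@grid_le1 phi i).
Qed.

Lemma sp_integral_sub_sqr_le phi psi :
  (\int[P]_w (`|sp_integral phi w - sp_integral psi w| ^+ 2)%:E <=
   6%:E * sq_norm P (fun s w => sp_eval phi s w - sp_eval psi s w)%R)%E.
Proof.
pose I := ('I_(sp_size phi) + 'I_(sp_size psi))%type.
pose a (i : I) := match i with inl j => sp_grid phi j | inr j => sp_grid psi j end.
pose b (i : I) :=
  match i with inl j => sp_grid phi j.+1 | inr j => sp_grid psi j.+1 end.
pose xi (i : I) w :=
  match i with inl j => sp_weight phi j w | inr j => - sp_weight psi j w end.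
have a0 i : 0 <= a i by case: i => j; exact: grid_ge0.
have ab i : a i <= b i by case: i => j; exact: grid_nd.
have b1 i : b i <= 1 by case: i => j; exact: grid_le1.
have mxi i : rv_measurable_wrt (natural_filtration B (a i)) (xi i).
  case: i => j; first exact: weight_measurable.
  move=> U mU; rewrite [X in natural_filtration _ _ X](_ : _ =
    sp_weight psi j @^-1` (-%R @^-1` U))//.
  apply: weight_measurable; rewrite -[_ @^-1` _]setTI.
  exact: (@oppr_measurable _ setT).
have := elem_integral_sqr_le B_brownian a0 ab b1 mxi.
under eq_integral => w _.
  rewrite big_sumType/=.
  under [X in _ + X]eq_bigr do rewrite mulNr.
  rewrite sumrN -real_normK ?num_real//.
  over.
rewrite (_ : elem_eval a b xi = fun s w => sp_eval phi s w - sp_eval psi s w)//.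
apply/funext => s; apply/funext => w; rewrite /elem_eval big_sumType/=.
by under [X in _ + X]eq_bigr do rewrite mulNr; rewrite sumrN.
Qed.

(** The differences of the approximants [phi k] and [psi k] approximate [H1 - H2], and their
    integrals approximate [Z1 - Z2], so the bound for simple processes passes to the limit. *)
Lemma ito_integral_sub_sqr_le H1 H2 Z1 Z2 :
  is_ito_integral P B H1 Z1 -> is_ito_integral P B H2 Z2 ->
  (\int[P]_w (`|Z1 w - Z2 w| ^+ 2)%:E <=
   96%:E * sq_norm P (fun s w => H1 s w - H2 s w)%R)%E.
Proof.
move=> [[mH1 _ _] mZ1 [phi [H1phi Z1phi]]] [[mH2 _ _] mZ2 [psi [H2psi Z2psi]]].
set S := sq_norm _ _.
have S0 : (0 <= S)%E.
  by apply: integral_ge0 => w _; apply: integral_ge0 => s _; rewrite lee_fin sqr_ge0.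
move: Z1phi Z2psi; rewrite unlock; set e1 := fun k : nat => _; set e2 := fun k : nat => _.
move=> Z1phi Z2psi.
move: H1phi H2psi; set s1 := fun k : nat => _; set s2 := fun k : nat => _.
move=> H1phi H2psi.
(* Two uses of the factor-2 inequality on the random variables, the simple isometry with its 6, and
   two more uses on the integrands: [S] carries 2 * 2 * 6 * 2 * 2 = 96, and all other terms tend to
   0. *)
pose bound k := (2%:E * e1 k + 2%:E * (2%:E * (6%:E * (2%:E * s1 k +
  2%:E * (2%:E * S + 2%:E * s2 k))) + 2%:E * e2 k))%E.
have le_bound k : (\int[P]_w (`|Z1 w - Z2 w| ^+ 2)%:E <= bound k)%E.
  have mphi := measurable_sp_integral (phi k).
  have mpsi := measurable_sp_integral (psi k).
  pose I1 := sp_integral (phi k); pose I2 := sp_integral (psi k).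
  have -> : (fun w => (`|Z1 w - Z2 w| ^+ 2)%:E) =
      (fun w => (`|(Z1 w - I1 w) + ((I1 w - I2 w) + (I2 w - Z2 w))| ^+ 2)%:E).
    by apply/funext => w; congr (`|_| ^+ 2)%:E; ring.
  apply: (le_trans (integral_sqr_leD _ _ _ _)) => //.
  - exact: measurable_funB.
  - by apply: measurable_funD; exact: measurable_funB.
  apply: leeD => //; apply: lee_wpmul2l => //.
  apply: (le_trans (integral_sqr_leD _ _ _ _)) => //; [exact: measurable_funB..|].
  apply: leeD; last first.
    by rewrite /e2; under eq_integral do rewrite distrC.
  apply: lee_wpmul2l => //.
  apply: (le_trans (sp_integral_sub_sqr_le _ _)); apply: lee_wpmul2l => //.
  have mf := sp_eval_jointly_measurable (phi k).
  have mg := sp_eval_jointly_measurable (psi k).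
  pose f := sp_eval (phi k); pose g := sp_eval (psi k).
  have -> : (fun s w => sp_eval (phi k) s w - sp_eval (psi k) s w) =
      (fun s w => (f s w - H1 s w) +
        ((H1 s w - H2 s w) + (H2 s w - g s w))).
    by apply/funext => s; apply/funext => w; rewrite /f /g; ring.
  apply: (le_trans (sq_norm_on_leD _ _ _ _)) => //.
  - exact: measurable_funB.
  - by apply: measurable_funD; exact: measurable_funB.
  have -> : s1 k = sq_norm_on P `[0%R, 1%R] (fun s w => f s w - H1 s w).
    apply: eq_integral => w _; apply: eq_integral => s _.
    by rewrite -/(f s w) distrC.
  apply: leeD => //.
  by apply: lee_wpmul2l => //; apply: sq_norm_on_leD => //; exact: measurable_funB.
have cvg2 (u : nat -> \bar R) l c : (u @ \oo --> l)%E ->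
    (c%:E * u k @[k --> \oo] --> c%:E * l)%E by move=> ul; exact: cvgeZl.
have cvg_bound : (bound @ \oo --> 96%:E * S)%E.
  have -> : (96%:E * S = 2%:E * 0 + 2%:E * (2%:E * (6%:E * (2%:E * 0 +
      2%:E * (2%:E * S + 2%:E * 0))) + 2%:E * 0))%E.
    rewrite !mule0 !add0e !adde0 !muleA -!EFinM; congr (_%:E * _)%E; lra.
  (* Finiteness of [S] has not been established; nonnegative limits suffice to rule out an undefined
     extended sum. *)
  have cvgD0 (u v : nat -> \bar R) x y : (0 <= x -> 0 <= y -> u @ \oo --> x ->
      v @ \oo --> y -> (fun k => u k + v k) @ \oo --> x + y)%E.
    by move=> x0 y0 ux vy; apply: cvgeD => //; apply: ge0_adde_def; rewrite inE.
  have S2 : (0 <= 2%:E * S)%E by exact: mule_ge0.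
  have z0 : (0 <= 2%:E * 0 :> \bar R)%E by rewrite mule0.
  have two0 : (0 <= 2%:E :> \bar R)%E by rewrite lee_fin.
  have c1 : (2%:E * S + 2%:E * s2 k @[k --> \oo] --> 2%:E * S + 2%:E * 0)%E.
    by apply: (cvgD0 (fun=> 2%:E * S)%E (fun k => 2%:E * s2 k)%E _ _ S2 z0);
      [exact: cvg_cst|exact: cvg2].
  have p1 : (0 <= 2%:E * S + 2%:E * 0)%E by rewrite adde_ge0.
  have c2 := cvgD0 _ _ _ _ z0 (mule_ge0 two0 p1)
    (cvg2 _ _ 2 H1phi) (cvg2 _ _ 2 c1).
  have p2 : (0 <= 2%:E * 0 + 2%:E * (2%:E * S + 2%:E * 0))%E.
    by rewrite adde_ge0// mule_ge0.
  have c3 := cvgD0 _ _ _ _ _ z0 (cvg2 _ _ 2 (cvg2 _ _ 6 c2)) (cvg2 _ _ 2 Z2psi).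
  apply: (cvgD0 _ _ _ _ z0 _ (cvg2 _ _ 2 Z1phi) (cvg2 _ _ 2 (c3 _))).
    by rewrite mule_ge0// adde_ge0// mule_ge0// mule_ge0.
  by rewrite mule_ge0// mule_ge0.
rewrite -(cvg_lim _ cvg_bound)//; apply: lime_ge.
  by apply/cvg_ex; eexists; exact: cvg_bound.
by apply: nearW.
Qed.

End ito_isometry.

(** * The integral of a power with negative exponent, cut off before its singularity *)

Section power_integral.
Context (R : realType).
Implicit Types (p u h s : R).

Lemma continuous_powR_pos p (x : R) : 0 < x -> {for x, continuous ((@powR R) ^~ p)}.
Proof.
move=> x0; apply/differentiable_continuous/derivable1_diffP.
by apply: derivable_powR; rewrite in_itv/= x0.
Qed.

Let is_derive_shift p u s : s < u ->
  is_derive s 1 (fun s => (u - s) `^ p : R) (- (p * (u - s) `^ (p - 1))).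
Proof.
move=> su.
have us0 : 0 < u - s by rewrite subr_gt0.
have dpow := is_derive1_powR p us0.
have dlin : is_derive s 1 (fun s : R => u - s) (0 - 1).
  exact: (is_deriveB (is_derive_cst u s 1) (is_derive_id s 1)).
by apply: (is_derive_eq (@is_derive1_comp _ ((@powR R) ^~ p) (fun s => u - s) s _ _ dpow dlin));
  rewrite sub0r mulrN1.
Qed.

Lemma integral_powR_shift p u h : p != 0 -> 0 < h -> h < u ->
  (\int[lebesgue_measure]_(s in `[0%R, (u - h)%R]) ((u - s) `^ (p - 1))%:E =
   ((u `^ p - h `^ p) / p)%:E)%E.
Proof.
move=> p0 h0 hu; have uh0 : 0 < u - h by rewrite subr_gt0.
have pos s : s <= u - h -> s < u.
  by move=> suh; rewrite (le_lt_trans suh)// ltrBlDr ltrDl.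
pose F s : R := - ((u - s) `^ p / p).
have dF s : s <= u - h -> is_derive s 1 F ((u - s) `^ (p - 1)).
  move=> /pos su; have := @is_derive_shift p u s su => d.
  have -> : F = (- p^-1) \*: (fun s => (u - s) `^ p : R).
    by apply/funext => x; rewrite /F/= /GRing.scale/= mulNr mulrC.
  apply: (is_derive_eq (is_deriveZ _ d)).
  by rewrite /GRing.scale/= mulrNN mulrA mulVf// mul1r.
have cF s : s <= u - h -> {for s, continuous F}.
  move=> sh; apply/differentiable_continuous/derivable1_diffP.
  by have [] := dF s sh.
rewrite (@continuous_FTC2 _ _ F)//.
- by rewrite -EFinB; congr _%:E; rewrite /F subr0 subKr; field.
- apply: continuous_in_subspaceT => s; rewrite inE/= in_itv/= => /andP[_ suh].
  apply/differentiable_continuous/derivable1_diffP.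
  by have [] := @is_derive_shift (p - 1) u s (pos s suh).
- split.
  + by move=> s; rewrite in_itv/= => /andP[_ /ltW suh]; have [] := dF s suh.
  + by apply: cvg_at_right_filter; apply: cF; exact: ltW.
  + by apply: cvg_at_left_filter; exact: cF.
- move=> s; rewrite in_itv/= => /andP[_ /ltW suh].
  by rewrite derive1E; have [_ ->] := dF s suh.
Qed.

Lemma integral_powR_shift_le p u h : p < 0 -> 0 < h ->
  (\int[lebesgue_measure]_(s in `[0%R, (u - h)%R[) ((u - s) `^ (p - 1))%:E <=
   (h `^ p / - p)%:E)%E.
Proof.
move=> p0 h0; have np0 : 0 < - p by rewrite oppr_gt0.
have [uh|hu] := leP u h.
  rewrite set_itv_ge ?integral_set0 ?lee_fin ?divr_ge0 ?powR_ge0 ?ltW//.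
  by rewrite bnd_simp -leNgt subr_le0.
apply: (@le_trans _ _ (\int[lebesgue_measure]_(s in `[0%R, (u - h)%R])
    ((u - s) `^ (p - 1))%:E)%E).
  apply: ge0_subset_integral => //=.
  - apply/measurable_EFinP/measurable_funTS.
    apply: (measurableT_comp (f := (@powR R) ^~ (p - 1))) => //.
    exact: measurable_funB.
  - by move=> s _; rewrite lee_fin powR_ge0.
  - by move=> s /=; rewrite !in_itv/= => /andP[-> /ltW].
rewrite integral_powR_shift ?lt_eqF// lee_fin.
rewrite [leLHS](_ : _ = (h `^ p - u `^ p) / - p).
  rewrite ler_pM2r ?invr_gt0//.
  by rewrite lerBlDr lerDl powR_ge0.
by rewrite invrN mulrN -mulNr opprB.
Qed.

End power_integral.

(** * Pathwise estimates for the kernel *)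

Section kernel.
Context (R : realType).
Implicit Types (al be u t h s v : R).

Lemma powRB_sqr_le_near al be v h : 0 < be -> be <= al -> al <= 1 ->
  0 <= v -> v <= h -> 0 < h -> h <= 1 ->
  `|(v + h) `^ al - v `^ al| ^+ 2 <= 4 * (h `^ be) ^+ 2.
Proof.
move=> be0 beal al1 v0 vh h0 h1; have al0 := lt_le_trans be0 beal.
have -> : 4 * (h `^ be) ^+ 2 = (2 * h `^ be) ^+ 2 by ring.
rewrite ler_pXn2r ?nnegrE ?mulr_ge0 ?powR_ge0//.
have le2 : (v + h) `^ al <= 2 * h `^ be.
  apply: (@le_trans _ _ ((2 * h) `^ al)).
    by apply: ge0_ler_powR; rewrite ?nnegrE; lra.
  rewrite powRM ?(ltW h0)// ler_pM ?powR_ge0//.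
    by rewrite -[leRHS]powRr1// ler_powR// ler1n.
  by rewrite ger_powR// h0.
rewrite ger0_norm.
  by apply: le_trans le2; rewrite lerBlDr lerDl powR_ge0.
rewrite subr_ge0; apply: ge0_ler_powR; rewrite ?nnegrE//; lra.
Qed.

Lemma powRB_sqr_le_far al be v h : 0 < be -> be <= al -> al <= 1 ->
  0 < v -> v <= 1 -> 0 < h ->
  `|(v + h) `^ al - v `^ al| ^+ 2 <= h ^+ 2 * v `^ (2 * be - 1 - 1).
Proof.
move=> be0 beal al1 v0 v1 h0; have al0 := lt_le_trans be0 beal.
have vvh : v < v + h by rewrite ltrDl.
have [] := @MVT R ((@powR R) ^~ al) (fun x => al * x `^ (al - 1)) v (v + h) vvh.
- move=> x; rewrite in_itv/= => /andP[vx _]; apply: is_derive1_powR.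
  exact: lt_trans vx.
- apply: continuous_in_subspaceT => x; rewrite inE/= in_itv/= => /andP[vx _].
  by apply: continuous_powR_pos; exact: lt_le_trans vx.
move=> x; rewrite in_itv/= => /andP[vx _] ->; rewrite [v + h]addrC addrK.
have -> : h ^+ 2 * v `^ (2 * be - 1 - 1) = (v `^ (be - 1) * h) ^+ 2.
  rewrite exprMn mulrC; congr (_ * _).
  by rewrite -powR_mulrn ?powR_ge0// -powRrM; congr (_ `^ _); ring.
rewrite ler_pXn2r ?nnegrE ?mulr_ge0 ?powR_ge0 ?(ltW h0)//.
have x0 := lt_trans v0 vx.
rewrite normrM (gtr0_norm h0) ler_pM2r// ger0_norm ?mulr_ge0 ?powR_ge0 ?(ltW al0)//.
rewrite -[leRHS]mul1r ler_pM ?powR_ge0 ?(ltW al0)//.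
apply: (@le_trans _ _ (v `^ (al - 1))).
  rewrite -(opprB 1) !powRN lef_pV2 ?posrE ?powR_gt0//.
  by apply: ge0_ler_powR; rewrite ?nnegrE ?subr_ge0 ?(ltW v0) ?(ltW x0) ?(ltW vx).
by rewrite ger_powR ?v0// lerD2r.
Qed.

Variables (Omega : Type) (A : R -> Omega -> R) (a_low a_up : R).
Hypotheses (a_low_gt : 2^-1 < a_low) (a_up_lt : a_up < 1).
Hypothesis A_range : forall (s : R) w, s \in `[0, 1] -> a_low <= A s w <= a_up.

Lemma kernel_power_sub_sqr_le w u t s : 0 <= u -> u < t -> t <= 1 ->
  s \in `[0, 1] ->
  `|kernel_power A t s w - kernel_power A u s w| ^+ 2 <=
  4 * ((t - u) `^ (a_low - 2^-1)) ^+ 2 * \1_(`[u - (t - u), t]) s +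
  (t - u) ^+ 2 * ((u - s) `^ (2 * (a_low - 2^-1) - 1 - 1)
    * \1_(`[0, u - (t - u)[) s).
Proof.
move=> u0 ut t1 s01; have /andP[lowA Aup] := A_range w s01.
move: s01; rewrite in_itv/= => /andP[s0 s1].
set h := t - u; have h0 : 0 < h by rewrite subr_gt0.
have h1 : h <= 1 by rewrite /h; lra.
set be := a_low - 2^-1; set al := A s w - 2^-1.
have be0 : 0 < be by rewrite subr_gt0.
have beal : be <= al by rewrite lerD2r.
have al1 : al <= 1.
  by rewrite lerBlDr (le_trans Aup)// (le_trans (ltW a_up_lt))// lerDl invr_ge0.
have R0 : 0 <= h ^+ 2 * ((u - s) `^ (2 * be - 1 - 1) * \1_(`[0, u - h[) s).
  by rewrite mulr_ge0 ?sqr_ge0// mulr_ge0 ?powR_ge0.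
have L0 : 0 <= 4 * (h `^ be) ^+ 2 * \1_(`[u - h, t]) s.
  by rewrite mulr_ge0// mulr_ge0 ?sqr_ge0.
rewrite /kernel_power; have [ts|st] := leP t s.
  by rewrite (le_trans (ltW ut) ts) subrr normr0 expr0n/= addr_ge0.
have [uhs|suh] := leP (u - h) s.
  rewrite -[leLHS]addr0 lerD// indicE mem_set/= ?in_itv/= ?uhs ?(ltW st)// mulr1.
  have [us|su] := leP u s.
    rewrite subr0 -/al; have := @powRB_sqr_le_near al be 0 (t - s).
    rewrite add0r powR0 ?gt_eqF ?(lt_le_trans be0 beal)// subr0 => H.
    apply: (le_trans (H _ _ _ _ _ _ _)) => //; [lra..|].
    rewrite ler_pM2l// ler_pXn2r ?nnegrE ?powR_ge0//.
    by apply: ge0_ler_powR; rewrite ?nnegrE /h; lra.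
  rewrite -/al (_ : t - s = (u - s) + h); last by rewrite /h; ring.
  by apply: powRB_sqr_le_near => //; lra.
have su : s < u by lra.
rewrite (leNgt u s) su/= -/al -[leLHS]add0r lerD//.
rewrite indicE mem_set/= ?in_itv/= ?s0// mulr1.
rewrite (_ : t - s = (u - s) + h); last by rewrite /h; ring.
by apply: powRB_sqr_le_far => //; lra.
Qed.

Lemma integral_kernel_power_sub_sqr_le w u t : a_low <= a_up ->
  0 <= u -> u < t -> t <= 1 ->
  measurable_fun (`[0, 1] : set R) (fun s => kernel_power A t s w - kernel_power A u s w) ->
  (\int[lebesgue_measure]_(s in `[0%R, 1%R])
     (`|kernel_power A t s w - kernel_power A u s w| ^+ 2)%:E <=
   ((8 + (1 - 2 * (a_low - 2^-1))^-1) * (t - u) `^ (2 * a_low))%:E)%E.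
Proof.
move=> a_le u0 ut t1 mk.
set h := t - u; have h0 : 0 < h by rewrite subr_gt0.
set be := a_low - 2^-1; have be0 : 0 < be by rewrite subr_gt0.
pose p := 2 * be - 1.
have p0 : p < 0 by move: (a_up_lt) => a1; rewrite /p /be; lra.
have mpow : measurable_fun setT (fun s : R => (u - s) `^ (p - 1)).
  apply: (measurableT_comp (f := (@powR R) ^~ (p - 1))) => //.
  exact: measurable_funB.
pose c1 := 4 * (h `^ be) ^+ 2.
have c10 : 0 <= c1 by rewrite mulr_ge0// sqr_ge0.
have c20 : 0 <= h ^+ 2 by exact: sqr_ge0.
pose f1 (s : R) : \bar R := (c1%:E * (\1_(`[u - h, t]) s)%:E)%E.
pose f2 (s : R) : \bar R :=
  ((h ^+ 2)%:E * (((u - s) `^ (p - 1))%:E * (\1_(`[0%R, (u - h)%R[) s)%:E))%E.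
have mf1 : measurable_fun (`[0, 1] : set R) f1.
  by apply: measurable_funTS; apply: emeasurable_funM => //; exact/measurable_EFinP.
have mf2' : measurable_fun (`[0, 1] : set R)
    (fun s => ((u - s) `^ (p - 1))%:E * (\1_(`[0%R, (u - h)%R[) s)%:E)%E.
  by apply: measurable_funTS; apply: emeasurable_funM => //; exact/measurable_EFinP.
have mf2 : measurable_fun (`[0, 1] : set R) f2 by exact: emeasurable_funM.
have f10 s : (0 <= f1 s)%E by rewrite mule_ge0 ?lee_fin.
have f20' s : (0 <= ((u - s) `^ (p - 1))%:E * (\1_(`[0%R, (u - h)%R[) s)%:E)%E.
  by rewrite mule_ge0 ?lee_fin ?powR_ge0.
have f20 s : (0 <= f2 s)%E by apply: mule_ge0 (f20' s); rewrite lee_fin.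
apply: (@le_trans _ _ (\int[lebesgue_measure]_(s in `[0%R, 1%R]) (f1 s + f2 s))%E).
  apply: ge0_le_integral => //.
  - exact/measurable_EFinP/measurable_funX/measurableT_comp.
  - exact: emeasurable_funD.
  - by move=> s s01; rewrite /f1 /f2 -!EFinM -EFinD lee_fin kernel_power_sub_sqr_le.
rewrite ge0_integralD//.
(* The near part contributes its bound [c1] times the length [2 * h] of [[u - h, t]], hence the 8;
   the far part contributes [1 / - p]. Both scale as [h] to the power [1 + 2 * be = 2 * a_low]. *)
have -> : (8 + (1 - 2 * be)^-1) * h `^ (2 * a_low) =
    c1 * (2 * h) + h ^+ 2 * (h `^ p / - p).
  have -> : h `^ (2 * a_low) = h * (h `^ be) ^+ 2.
    rewrite -powR_mulrn ?powR_ge0// -powRrM -{2}(powRr1 (ltW h0)) -powRD.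
      by congr (_ `^ _); rewrite /be; field.
    by rewrite (gt_eqF h0) implybT.
  have -> : h `^ p = (h `^ be) ^+ 2 / h.
    rewrite -powR_mulrn ?powR_ge0// -powRrM -(powR_inv1 (ltW h0)) -powRD.
      by congr (_ `^ _); rewrite /p; ring.
    by rewrite (gt_eqF h0) implybT.
  rewrite /c1 /p; field.
  move: (a_up_lt) => a1; apply/and3P; split; [by rewrite lt_eqF|by rewrite gt_eqF|].
  by rewrite gt_eqF// /be; lra.
rewrite EFinD leeD//.
- rewrite /f1 ge0_integralZl//; last exact/measurable_EFinP/measurable_funTS.
  rewrite integral_indic// (EFinM c1) lee_wpmul2l ?lee_fin//.
  apply: (@le_trans _ _ (lebesgue_measure (`[u - h, t]%classic : set R))).
    by rewrite le_measure ?inE//; exact: measurableI.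
  rewrite lebesgue_measure_itv/= lte_fin ifT; last by rewrite /h; lra.
  by rewrite -EFinB lee_fin /h; lra.
- rewrite /f2 ge0_integralZl// (EFinM (h ^+ 2)) lee_wpmul2l ?lee_fin//.
  rewrite [leLHS](_ : _ = (\int[lebesgue_measure]_(s in
      `[0%R, 1%R] `&` `[0%R, (u - h)%R[) ((u - s) `^ (p - 1))%:E)%E); last first.
    rewrite integral_mkcondr; apply: eq_integral => s _.
    by rewrite patchE indicE; case: ifPn => _; rewrite ?mule1 ?mule0.
  apply: le_trans (integral_powR_shift_le u p0 h0).
  apply: ge0_subset_integral => //; first exact: measurableI.
  + exact/measurable_EFinP/measurable_funTS.
  + by move=> s _; rewrite lee_fin powR_ge0.
Qed.

End kernel.

Lemma sq_norm_kernel_power_sub_le d (Omega : measurableType d) (R : realType)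
    (P : probability Omega R) (A : R -> Omega -> R) (a_low a_up u t : R) :
  2^-1 < a_low -> a_low <= a_up -> a_up < 1 ->
  (forall (s : R) w, s \in `[0, 1] -> a_low <= A s w <= a_up) ->
  0 <= u -> u < t -> t <= 1 ->
  jointly_measurable_on `[0, 1] (kernel_power A u) ->
  jointly_measurable_on `[0, 1] (kernel_power A t) ->
  (sq_norm P (fun s w => kernel_power A t s w - kernel_power A u s w)%R <=
   ((8 + (1 - 2 * (a_low - 2^-1))^-1) * (t - u) `^ (2 * a_low))%:E)%E.
Proof.
move=> a_low_gt a_le a_up_lt A_range u0 ut t1 mu mt.
set c := _ * _.
have mut : jointly_measurable_on `[0, 1]
    (fun s w => kernel_power A t s w - kernel_power A u s w).
  exact: measurable_funB.
apply: (@le_trans _ _ (\int[P]_w (cst c%:E w))%E).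
  apply: ge0_le_integral => //.
  - by move=> w _; apply: integral_ge0 => s _; rewrite lee_fin sqr_ge0.
  - exact: measurable_sq_section.
  - move=> w _; apply: (integral_kernel_power_sub_sqr_le a_low_gt a_up_lt A_range) => //.
    by apply: (jointly_measurable_section w _ mut).
by rewrite integral_cst// [X in (_ * X)%E](@probability_setT _ _ _ P) mule1.
Qed.

(** * Hölder extension from dyadic points *)

Section dyadic.
Context (R : realType).
Implicit Types (f : R -> R) (t x y r M zeta : R) (n k : nat).

Definition dyadic n k : R := k%:R / 2 ^+ n.

Definition dyadic_index n t : nat := Num.trunc (2 ^+ n * t).

Definition dyadic_floor n t : R := dyadic n (dyadic_index n t).

(** Depends on [f] only through its values at dyadic points, so countably many increments control
    it. *)
Definition dyadic_limit f t : R := limn (fun n => f (dyadic_floor n t)).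

Let pow2_gt0 n : 0 < 2 ^+ n :> R. Proof. by rewrite exprn_gt0. Qed.

Lemma dyadic_index_itv n t : 0 <= t ->
  (dyadic_index n t)%:R <= 2 ^+ n * t < (dyadic_index n t).+1%:R.
Proof. by move=> t0; apply: truncn_itv; rewrite mulr_ge0// ltW. Qed.

Lemma dyadic_index_le n t : 0 <= t -> t <= 1 -> (dyadic_index n t <= 2 ^ n)%N.
Proof.
move=> t0 t1; have /andP[lb _] := dyadic_index_itv n t0.
rewrite -(ler_nat R) natrX (le_trans lb)// ger_pMr//.
Qed.

Lemma dyadic_double n k : dyadic n.+1 k.*2 = dyadic n k.
Proof.
by rewrite /dyadic -muln2 natrM exprS; field; rewrite gt_eqF.
Qed.

(** One more binary digit: from level [n] to [n.+1] the floor of [t] stays or moves right by one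
    cell of the finer grid, so the change in [f] is a single increment. *)
Lemma dyadic_index_succ n t : 0 <= t ->
  dyadic_index n.+1 t = (dyadic_index n t).*2 \/
  dyadic_index n.+1 t = (dyadic_index n t).*2.+1.
Proof.
move=> t0; have /andP[a1 a2] := dyadic_index_itv n t0.
have /andP[b1 b2] := dyadic_index_itv n.+1 t0.
set k := dyadic_index n t in a1 a2 *; set m := dyadic_index n.+1 t in b1 b2 *.
have e : 2 ^+ n.+1 * t = 2 * (2 ^+ n * t) by rewrite exprS mulrA.
have km : (k.*2 < m.+1)%N.
  rewrite -(ltr_nat R) -muln2 natrM; apply: le_lt_trans b2.
  by rewrite e mulrC ler_pM2l.
have mk : (m < k.+1.*2)%N.
  rewrite -(ltr_nat R) -muln2 natrM; apply: le_lt_trans b1 _.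
  by rewrite e mulrC ltr_pM2r.
move: km mk; rewrite ltnS doubleS => km mk.
have := leq_eqVlt k.*2 m; rewrite km => /esym/orP[/eqP->|km']; first by left.
by right; apply/eqP; rewrite eqn_leq km' andbT -ltnS.
Qed.

Lemma dyadic_floor_dist n t : 0 <= t -> `|t - dyadic_floor n t| <= 2^-1 ^+ n.
Proof.
move=> t0; have /andP[lb ub] := dyadic_index_itv n t0.
have -> : t - dyadic_floor n t = (2 ^+ n * t - (dyadic_index n t)%:R) / 2 ^+ n.
  by rewrite mulrBl [2 ^+ n * t]mulrC mulfK// gt_eqF.
rewrite normrM normfV (gtr0_norm (pow2_gt0 n)) exprVn ger0_norm ?subr_ge0//.
by rewrite ler_piMl ?invr_ge0 ?(ltW (pow2_gt0 n))// lerBlDl natr1 ltW.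
Qed.

Lemma dyadic_floor_itv n t : 0 <= t -> t <= 1 -> 0 <= dyadic_floor n t <= 1.
Proof.
move=> t0 t1; rewrite divr_ge0 ?(ltW (pow2_gt0 n))//= /dyadic_floor /dyadic.
rewrite ler_pdivrMr// mul1r -natrX ler_nat.
exact: dyadic_index_le.
Qed.

Variables (f : R -> R) (M r : R).
Hypotheses (r0 : 0 < r) (r1 : r < 1).
Hypothesis incr : forall n k, (k < 2 ^ n)%N ->
  `|f (dyadic n k.+1) - f (dyadic n k)| <= M * r ^+ n.

Let M0 : 0 <= M.
Proof. by have := incr (n := 0) (k := 0) isT; rewrite expr0 mulr1; apply: le_trans. Qed.

Let step n t : 0 <= t -> t <= 1 ->
  `|f (dyadic_floor n.+1 t) - f (dyadic_floor n t)| <= M * r ^+ n.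
Proof.
move=> t0 t1; rewrite /dyadic_floor -(dyadic_double n).
have [->|e] := dyadic_index_succ n t0.
  by rewrite subrr normr0 mulr_ge0// exprn_ge0// ltW.
rewrite e; apply: (@le_trans _ _ (M * r ^+ n.+1)); last first.
  by rewrite ler_wpM2l// exprS ler_piMl ?exprn_ge0 ?ltW.
by apply: incr; rewrite -e; exact: dyadic_index_le.
Qed.

(** The geometric sum is kept in closed form, because the weaker bound of [tail_le] would not
    survive the induction on [m]. *)
Let tail n m t : 0 <= t -> t <= 1 -> (n <= m)%N ->
  `|f (dyadic_floor m t) - f (dyadic_floor n t)| <=
  M / (1 - r) * (r ^+ n - r ^+ m).
Proof.
move=> t0 t1; elim: m => [|m IH]; first by rewrite leqn0 => /eqP->; rewrite !subrr normr0 mulr0.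
rewrite leq_eqVlt => /predU1P[->|]; first by rewrite !subrr normr0 mulr0.
rewrite ltnS => /IH {}IH.
rewrite -(subrK (f (dyadic_floor m t)) (f (dyadic_floor m.+1 t))) -addrA.
apply: (le_trans (ler_normD _ _)); apply: (le_trans (lerD (step m t0 t1) IH)).
rewrite le_eqVlt; apply/orP; left; apply/eqP; rewrite exprS; field.
by rewrite subr_eq0 gt_eqF.
Qed.

Let tail_le n m t : 0 <= t -> t <= 1 -> (n <= m)%N ->
  `|f (dyadic_floor m t) - f (dyadic_floor n t)| <= M / (1 - r) * r ^+ n.
Proof.
move=> t0 t1 nm; apply: (le_trans (tail t0 t1 nm)).
apply: ler_wpM2l; first by rewrite divr_ge0// subr_ge0 ltW.
by rewrite gerBl exprn_ge0// ltW.
Qed.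

Lemma dyadic_limit_cvg t : 0 <= t -> t <= 1 ->
  f (dyadic_floor n t) @[n --> \oo] --> dyadic_limit f t.
Proof.
move=> t0 t1; apply/cauchy_cvgP/cauchy_exP => e e0.
have /cvgrPdist_lt/(_ _ e0) : M / (1 - r) * r ^+ n @[n --> \oo] --> (0 : R).
  rewrite -[X in _ --> X](mulr0 (M / (1 - r))); apply: cvgM; first exact: cvg_cst.
  by apply: cvg_expr; rewrite ger0_norm// ltW.
move=> [n _ /(_ n (leqnn _))] /=; rewrite sub0r normrN => hn.
exists (f (dyadic_floor n t)); exists n => // m /= nm; rewrite /ball/= distrC.
exact: le_lt_trans (tail_le t0 t1 nm) (le_lt_trans (ler_norm _) hn).
Qed.

Let limit_dist n t : 0 <= t -> t <= 1 ->
  `|dyadic_limit f t - f (dyadic_floor n t)| <= M / (1 - r) * r ^+ n.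
Proof.
move=> t0 t1.
have cv : `|f (dyadic_floor m t) - f (dyadic_floor n t)| @[m --> \oo] -->
    `|dyadic_limit f t - f (dyadic_floor n t)|.
  by apply: cvg_norm; apply: cvgB; [exact: dyadic_limit_cvg|exact: cvg_cst].
rewrite -(cvg_lim _ cv)//; apply: limr_le; first by apply/cvg_ex; eexists; exact: cv.
by exists n => // m /= nm; exact: tail_le.
Qed.

(** Points at most one cell apart have equal or consecutive floors. *)
Let adjacent n x y : 0 <= x -> x <= y -> y <= 1 -> y - x <= 2^-1 ^+ n ->
  `|f (dyadic_floor n y) - f (dyadic_floor n x)| <= M * r ^+ n.
Proof.
move=> x0 xy y1 yx; have y0 := le_trans x0 xy.
have /andP[a1 a2] := dyadic_index_itv n x0.
have /andP[b1 b2] := dyadic_index_itv n y0.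
rewrite /dyadic_floor.
set k := dyadic_index n x in a1 a2 *; set m := dyadic_index n y in b1 b2 *.
have km : (k < m.+1)%N.
  by rewrite -(ltr_nat R) (le_lt_trans a1)// (le_lt_trans _ b2)// ler_pM2l.
have mk : (m < k.+2)%N.
  rewrite -(ltr_nat R) (le_lt_trans b1)// -natr1.
  have : 2 ^+ n * (y - x) <= 1.
    by rewrite -(ler_pM2l (pow2_gt0 n)) exprVn mulfV ?gt_eqF in yx.
  by rewrite mulrBr; lra.
have := leq_eqVlt k m; rewrite -ltnS km => /esym/orP[/eqP->|km'].
  by rewrite subrr normr0 mulr_ge0// exprn_ge0// ltW.
have e : m = k.+1 by apply/eqP; rewrite eqn_leq km' andbT -ltnS.
by rewrite e; apply: incr; rewrite -e; exact: dyadic_index_le.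
Qed.

Lemma dyadic_limit_dist n x y : 0 <= x -> x <= y -> y <= 1 ->
  y - x <= 2^-1 ^+ n ->
  `|dyadic_limit f y - dyadic_limit f x| <= (2 * (M / (1 - r)) + M) * r ^+ n.
Proof.
move=> x0 xy y1 yx; have y0 := le_trans x0 xy; have x1 := le_trans xy y1.
have hx := limit_dist n x0 x1; have hy := limit_dist n y0 y1.
have hxy := adjacent x0 xy y1 yx.
rewrite distrC in hx.
have -> : dyadic_limit f y - dyadic_limit f x =
  (dyadic_limit f y - f (dyadic_floor n y)) +
  ((f (dyadic_floor n y) - f (dyadic_floor n x)) +
   (f (dyadic_floor n x) - dyadic_limit f x)) by ring.
apply: (le_trans (ler_normD _ _)).
apply: (le_trans (lerD hy (le_trans (ler_normD _ _) (lerD hxy hx)))).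
by rewrite le_eqVlt; apply/orP; left; apply/eqP; ring.
Qed.

End dyadic.

Lemma dyadic_scale (R : realType) (h : R) : 0 < h -> h <= 1 ->
  exists n, 2^-1 ^+ n.+1 < h <= 2^-1 ^+ n.
Proof.
move=> h0 h1.
have : exists n, (2^-1 : R) ^+ n < h.
  have /cvgrPdist_lt/(_ _ h0) : (2^-1 : R) ^+ n @[n --> \oo] --> 0.
    by apply: cvg_expr; rewrite ger0_norm ?invr_ge0// invf_lt1// ltr1n.
  move=> [n _ /(_ n (leqnn _))] /=; rewrite sub0r normrN ger0_norm ?exprn_ge0 ?invr_ge0//.
  by exists n.
case/ex_minnP => -[|n] hn nmin; first by rewrite expr0 ltNge h1 in hn.
exists n; rewrite hn/= leNgt; apply/negP => /nmin; by rewrite ltnn.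
Qed.

Lemma hoelder_dyadic_limit (R : realType) (f : R -> R) (M zeta : R) :
  0 < zeta ->
  (forall n k, (k < 2 ^ n)%N ->
    `|f (dyadic R n k.+1) - f (dyadic R n k)| <= M * (2^-1 `^ zeta) ^+ n) ->
  hoelder_on_unit zeta (dyadic_limit f).
Proof.
move=> z0 incr; set r := 2^-1 `^ zeta in incr.
have r0 : 0 < r by rewrite powR_gt0// invr_gt0.
have r1 : r < 1.
  rewrite -[ltRHS](_ : 1 `^ zeta = 1); last by rewrite powR1.
   apply: gt0_ltr_powR; rewrite ?nnegrE ?invr_ge0//.
  by rewrite invf_lt1// ltr1n.
have M0 : 0 <= M.
  by have := incr 0%N 0%N isT; rewrite expr0 mulr1; apply: le_trans.
set C := 2 * (M / (1 - r)) + M.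
have C0 : 0 <= C by rewrite addr_ge0// mulr_ge0// divr_ge0// subr_ge0 ltW.
exists (C * 2 `^ zeta) => x y.
wlog xy : x y / x < y => [H x01 y01|].
  have [xy|yx|->] := ltgtP x y; first exact: H.
    by rewrite distrC [in leRHS]distrC; exact: H.
  by rewrite !subrr normr0 mulr_ge0 ?powR_ge0// mulr_ge0 ?powR_ge0.
rewrite !in_itv/= => /andP[x0 x1] /andP[y0 y1].
rewrite distrC [in leRHS]distrC.
have h0 : 0 < y - x by rewrite subr_gt0.
have [|n /andP[nh hn]] := dyadic_scale h0; first lra.
apply: (le_trans (dyadic_limit_dist r0 r1 incr x0 (ltW xy) y1 hn)).
rewrite -/C -mulrA; apply: ler_wpM2l => //.
rewrite gtr0_norm// -powRM ?(ltW h0)//.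
have -> : r ^+ n = (2^-1 ^+ n) `^ zeta.
  rewrite -(powR_mulrn n (ltW r0)) /r -powRrM [zeta * _]mulrC powRrM.
  by rewrite powR_mulrn ?invr_ge0.
apply: ge0_ler_powR; rewrite ?nnegrE ?exprn_ge0 ?invr_ge0 ?mulr_ge0 ?(ltW h0) ?(ltW z0)//.
by rewrite exprS in nh; rewrite -ler_pdivrMl// mulrC ltW// mulrC.
Qed.

(** * Kolmogorov's continuity criterion for second moments *)

Section kolmogorov.
Context d (Omega : measurableType d) (R : realType).
Variable P : probability Omega R.

(* The sum over [n] of the [W n] has a finite mean, hence is finite almost surely. *)
Lemma ae_bounded_of_geometric_mean (W : nat -> Omega -> R) (K q : R) :
  (forall n, measurable_fun setT (W n)) -> (forall n w, 0 <= W n w) ->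
  0 <= K -> 0 <= q -> q < 1 ->
  (forall n, (\int[P]_w (W n w)%:E <= (K * q ^+ n)%:E)%E) ->
  {ae P, forall w, exists M : R, forall n, W n w <= M}.
Proof.
move=> mW W0 K0 q0 q1 EW.
pose S w := (\sum_(0 <= n <oo) (W n w)%:E)%E.
have mS : measurable_fun setT S.
  apply: ge0_emeasurable_sum => //.
  - by move=> n w _ _; rewrite lee_fin.
  - by move=> n _; exact/measurable_EFinP.
have S0 w : (0 <= S w)%E by apply: nneseries_ge0 => n _ _; rewrite lee_fin.
have intS : P.-integrable setT S.
  apply/integrableP; split=> //.
  under eq_integral do rewrite gee0_abs//.
  rewrite integral_nneseries//; last 2 first.
  - by move=> n; exact/measurable_EFinP.
  - by move=> n w _; rewrite lee_fin.
  apply: (@le_lt_trans _ _ (K / (1 - q))%:E); last exact: ltry.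
  apply: lime_le.
    by apply: is_cvg_nneseries => n _ _; apply: integral_ge0 => w _; rewrite lee_fin.
  apply: nearW => n.
  apply: (@le_trans _ _ (\sum_(0 <= k < n) (K * q ^+ k)%:E)%E).
    by apply: lee_sum => k _; exact: EW.
  rewrite sumEFin lee_fin -mulr_sumr ler_wpM2l//.
  rewrite (_ : \sum_(0 <= k < n) q ^+ k = (1 - q ^+ n) / (1 - q)).
    by rewrite ler_piMl ?invr_ge0 ?subr_ge0 ?(ltW q1)// lerBlDr lerDl exprn_ge0.
  elim: n => [|n IH]; first by rewrite big_geq// expr0 subrr mul0r.
  rewrite big_nat_recr//= IH exprS; field.
  by rewrite subr_eq0 gt_eqF.
have := integrable_ae measurableT intS; apply: filterS => w /(_ I) Sfin.
exists (fine (S w)) => n; rewrite -lee_fin fineK//.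
apply: le_trans (nneseries_lim_ge n.+1 _); last by move=> k _ _; rewrite lee_fin.
by rewrite big_nat_recr//= leeDr// sume_ge0// => k _; rewrite lee_fin.
Qed.

Variables (X : R -> Omega -> R) (C de : R).
Hypotheses (C0 : 0 <= C) (de0 : 0 < de).
Hypothesis mX : forall t : R, 0 <= t <= 1 -> measurable_fun setT (X t).
Hypothesis X_moment : forall s t : R, 0 <= s <= 1 -> 0 <= t <= 1 ->
  (\int[P]_w (`|X s w - X t w| ^+ 2)%:E <= (C * `|s - t| `^ (1 + de))%:E)%E.

Let dyadic_itv n k : (k <= 2 ^ n)%N -> 0 <= dyadic R n k <= 1.
Proof.
move=> kn; have p0 : 0 < 2 ^+ n :> R by rewrite exprn_gt0.
rewrite /dyadic divr_ge0 ?(ltW p0)//= ler_pdivrMr// mul1r -natrX ler_nat.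
exact: kn.
Qed.

Let half_pow n (a : R) : ((2^-1 : R) ^+ n) `^ a = (2^-1 `^ a) ^+ n.
Proof.
rewrite -(powR_mulrn n (powR_ge0 _ _)) -powRrM [a * _]mulrC powRrM.
by rewrite powR_mulrn ?invr_ge0.
Qed.

Let msqX (s t : R) : 0 <= s <= 1 -> 0 <= t <= 1 ->
  measurable_fun setT (fun w => `|X s w - X t w| ^+ 2).
Proof.
move=> s01 t01; apply/measurable_funX/measurableT_comp => //.
by apply: measurable_funB; exact: mX.
Qed.

(** The largest squared increment at level [n] is bounded by the sum of all [2 ^ n] of them, whose
    mean is at most [C * (2^-1]^ de) ^+ n[. Dividing by]r ^+ n[squared leaves the ratio]2^-1
    [^ (de - 2 * zeta)], which is below 1. *)
Let ae_increments (zeta : R) : 0 < zeta -> 2 * zeta < de ->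
  {ae P, forall w, exists M : R, forall n k, (k < 2 ^ n)%N ->
    `|X (dyadic R n k.+1) w - X (dyadic R n k) w| <= M * (2^-1 `^ zeta) ^+ n}.
Proof.
move=> z0 zd; pose r : R := 2^-1 `^ zeta.
have r0 : 0 < r by rewrite powR_gt0// invr_gt0.
pose D n k w := `|X (dyadic R n k.+1) w - X (dyadic R n k) w| ^+ 2.
pose W n w := (r ^- n) ^+ 2 * \sum_(k < 2 ^ n) D n k w.
have mD n k : (k < 2 ^ n)%N -> measurable_fun setT (D n k).
  by move=> kn; apply: msqX; apply: dyadic_itv => //; exact: ltnW.
have W0 n w : 0 <= W n w.
  by rewrite mulr_ge0 ?sqr_ge0// sumr_ge0// => k _; rewrite /D sqr_ge0.
have q0 : 0 <= 2^-1 `^ (de - 2 * zeta) by exact: powR_ge0.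
have q1 : 2^-1 `^ (de - 2 * zeta) < 1.
  rewrite -[ltRHS](_ : 1 `^ (de - 2 * zeta) = 1); last by rewrite powR1.
  apply: gt0_ltr_powR; rewrite ?nnegrE ?invr_ge0 ?subr_gt0//.
  by rewrite invf_lt1// ltr1n.
have := @ae_bounded_of_geometric_mean W C (2^-1 `^ (de - 2 * zeta)) _ W0 C0 q0 q1.
have mW n : measurable_fun setT (W n).
  apply: measurable_funM => //.
  have -> : (fun w => \sum_(k < 2 ^ n) D n k w) =
      (fun w => \sum_(k <- index_enum 'I_(2 ^ n)) D n k w) by [].
  by apply: measurable_sum => k; exact: mD.
have EW n : (\int[P]_w (W n w)%:E <= (C * 2^-1 `^ (de - 2 * zeta) ^+ n)%:E)%E.
  pose h : R := 2^-1 ^+ n; have h0 : 0 < h by rewrite exprn_gt0// invr_gt0.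
  have rn : r ^+ n = h `^ zeta by rewrite half_pow.
  have rn0 : 0 < r ^+ n by rewrite exprn_gt0.
  under eq_integral do rewrite EFinM -sumEFin.
  rewrite ge0_integralZl//; last 3 first.
  - by apply: emeasurable_sum => k; apply/measurable_EFinP; exact: mD.
  - by move=> w _; apply: sume_ge0 => k _; rewrite lee_fin /D sqr_ge0.
  - by rewrite lee_fin sqr_ge0.
  rewrite ge0_integral_sum//; last 2 first.
  - by move=> k; apply/measurable_EFinP; exact: mD.
  - by move=> k w _; rewrite lee_fin /D sqr_ge0.
  apply: (@le_trans _ _ (((r ^- n) ^+ 2)%:E * \sum_(k < 2 ^ n) (C * h `^ (1 + de))%:E)%E).
    apply: lee_wpmul2l; first by rewrite lee_fin sqr_ge0.
    apply: lee_sum => k _.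
    have -> : h = `|dyadic R n k.+1 - dyadic R n k|.
      rewrite /dyadic -mulrBl -natr1 addrC addKr mul1r ger0_norm ?invr_ge0 ?exprn_ge0//.
      by rewrite /h exprVn.
    by apply: X_moment; apply: dyadic_itv => //; exact: ltnW.
  rewrite sumEFin -EFinM lee_fin sumr_const card_ord -half_pow -/h.
  have hn : (2 ^ n)%:R = h^-1 by rewrite natrX /h exprVn invrK.
  rewrite -(mulr_natl (C * h `^ (1 + de))) hn.
  have -> : h `^ (1 + de) = h * h `^ de.
    by rewrite powRD ?(gt_eqF h0) ?implybT// powRr1// ltW.
  have -> : h `^ (de - 2 * zeta) = h `^ de / (h `^ zeta) ^+ 2.
    rewrite powRB ?(gt_eqF h0) ?implybT//; congr (_ / _).
    by rewrite -powR_mulrn ?powR_ge0// -powRrM mulrC.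
  rewrite rn le_eqVlt; apply/orP; left; apply/eqP; field.
  by rewrite !gt_eqF// powR_gt0.
move=> /(_ mW EW); apply: filterS => w [M WM]; exists (Num.sqrt M) => n k kn.
have rn0 : 0 < r ^+ n by rewrite exprn_gt0.
have M0 : 0 <= M by exact: le_trans (W0 0%N w) (WM 0%N).
rewrite -/r -(@ler_pXn2r _ 2) ?nnegrE ?mulr_ge0 ?sqrtr_ge0 ?(ltW rn0)//.
rewrite exprMn sqr_sqrtr//.
apply: (@le_trans _ _ (\sum_(k < 2 ^ n) D n k w)).
  rewrite (bigD1 (Ordinal kn))//= lerDl sumr_ge0// => j _.
  by rewrite /D sqr_ge0.
have := WM n; rewrite /W exprVn mulrC ler_pdivrMr//.
exact: exprn_gt0.
Qed.

(** Identifies the dyadic limit with [X t]. Almost sure convergence of the whole sequence is needed,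
    and the moment bound is strong enough: even weighted by [2 ^+ n], the squared distances have
    geometrically small means. *)
Let ae_dyadic_floor (t : R) : 0 <= t <= 1 ->
  {ae P, forall w, X (dyadic_floor n t) w @[n --> \oo] --> X t w}.
Proof.
move=> t01; have /andP[t0 t1] := t01.
pose W n w := 2 ^+ n * `|X t w - X (dyadic_floor n t) w| ^+ 2.
have f01 n : 0 <= dyadic_floor n t <= 1 by exact: dyadic_floor_itv.
have mW n : measurable_fun setT (W n) by apply: measurable_funM => //; exact: msqX.
have W0 n w : 0 <= W n w by rewrite mulr_ge0 ?sqr_ge0// exprn_ge0.
have q0 : 0 <= 2^-1 `^ de by exact: powR_ge0.
have q1 : 2^-1 `^ de < 1.
  rewrite -[ltRHS](_ : 1 `^ de = 1); last by rewrite powR1.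
  by apply: gt0_ltr_powR; rewrite ?nnegrE ?invr_ge0// invf_lt1// ltr1n.
have := @ae_bounded_of_geometric_mean W C (2^-1 `^ de) mW W0 C0 q0 q1.
have EW n : (\int[P]_w (W n w)%:E <= (C * (2^-1 `^ de) ^+ n)%:E)%E.
  pose h : R := 2^-1 ^+ n; have h0 : 0 < h by rewrite exprn_gt0// invr_gt0.
  under eq_integral do rewrite EFinM.
  rewrite ge0_integralZl//; last by apply/measurable_EFinP; exact: msqX.
  apply: (@le_trans _ _ ((2 ^+ n)%:E * (C * `|t - dyadic_floor n t| `^ (1 + de))%:E)%E).
    by apply: lee_wpmul2l; [rewrite lee_fin exprn_ge0|exact: X_moment].
  rewrite -EFinM lee_fin mulrCA ler_wpM2l// -half_pow -/h.
  have -> : 2 ^+ n = h^-1 by rewrite /h exprVn invrK.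
  rewrite ler_pdivrMl//.
  have <- : h `^ (1 + de) = h * h `^ de.
    by rewrite powRD ?(gt_eqF h0) ?implybT// powRr1// ltW.
  apply: ge0_ler_powR; rewrite ?nnegrE ?addr_ge0 ?(ltW de0) ?(ltW h0)//.
  exact: dyadic_floor_dist.
move=> /(_ EW); apply: filterS => w [M WM].
have M0 : 0 <= M by exact: le_trans (W0 0%N w) (WM 0%N).
(* Boundedness of [W n w] in [n] says that the squared distance is at most [M / 2 ^+ n], so the
   distance decays like [q ^+ n]. *)
pose q : R := Num.sqrt 2^-1.
have qq : q ^+ 2 = 2^-1 by rewrite sqr_sqrtr// invr_ge0.
have qlt1 : `|q| < 1.
  by rewrite ger0_norm ?sqrtr_ge0// -sqrtr1 ltr_sqrt// invf_lt1// ltr1n.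
have le_q n : `|X t w - X (dyadic_floor n t) w| <= Num.sqrt M * q ^+ n.
  rewrite -(@ler_pXn2r _ 2) ?nnegrE ?mulr_ge0 ?exprn_ge0 ?sqrtr_ge0//.
  rewrite exprMn sqr_sqrtr// -exprM mulnC exprM qq exprVn.
  by rewrite ler_pdivlMr ?exprn_gt0// mulrC; exact: WM.
apply/cvgrPdist_le => e e0.
have : Num.sqrt M * q ^+ n @[n --> \oo] --> (0 : R).
  rewrite -[X in _ --> X](mulr0 (Num.sqrt M)); apply: cvgM; first exact: cvg_cst.
  exact: cvg_expr.
move=> /cvgrPdist_le/(_ _ e0); apply: filterS => n.
rewrite sub0r normrN; apply: le_trans; apply: (le_trans (le_q n)); exact: ler_norm.
Qed.

(* A single exceptional set has to serve all exponents, so the increments are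
   controlled along a sequence of exponents increasing to [de / 2]. *)
Lemma kolmogorov_continuity : measure_is_complete P ->
  exists Y : R -> Omega -> R, modification P X Y /\
    forall (w : Omega) (zeta : R), 0 < zeta -> zeta < de / 2 ->
      hoelder_on_unit zeta (fun t : R => Y t w).
Proof.
(* The shift by two makes already [z 0] positive. *)
move=> complete_P; pose z (m : nat) := de / 2 - de / 2 / m.+2%:R.
have m0 m : 0 < m.+2%:R :> R by [].
have d20 : 0 < de / 2 by rewrite divr_gt0.
pose good w := forall m, exists M : R, forall n k, (k < 2 ^ n)%N ->
  `|X (dyadic R n k.+1) w - X (dyadic R n k) w| <= M * (2^-1 `^ z m) ^+ n.
have ae_good : {ae P, forall w, good w}.
  apply: ae_foralln => m; apply: ae_increments.
    by rewrite subr_gt0 ltr_pdivrMr// ltr_pMr// ltr1n.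
  rewrite /z mulrBr [2 * (de / 2)]mulrC divfK// ltrBlDr ltrDl.
  by rewrite mulr_gt0// divr_gt0.
(* The zero path off [good] makes every path of [Y] Hölder continuous, not only almost every one. *)
pose Y t w := if `[< good w >] then dyadic_limit (X ^~ w) t else 0.
exists Y; split=> [t|w zeta z0 zd].
  rewrite in_itv/= => t01.
  have YX : {ae P, forall w, Y t w = X t w}.
    move: ae_good (ae_dyadic_floor t01); apply: filterS2 => w gw cw.
    by rewrite /Y asboolT//; apply/cvg_lim.
  split=> //; apply/measurable_EFinP.
  (* [good] has not been shown to be an event; completeness of [P] transfers measurability from
     [X t] to its almost sure copy [Y t]. *)
  apply: (ae_measurable_fun complete_P (f := EFin \o X t)).
    by move: YX; apply: filterS => w /= ->.
  by apply/measurable_EFinP; exact: mX.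
rewrite /Y; have [gw|ngw] := pselect (good w); last first.
  exists 0 => x y _ _; rewrite asboolF// subrr normr0.
  by rewrite mul0r.
have -> : (fun t => if `[< good w >] then dyadic_limit (X ^~ w) t else 0) =
  dyadic_limit (X ^~ w) by apply/funext => t; rewrite asboolT.
(* Chosen so that [de / 2 / m.+2%:R] is at most the gap [de / 2 - zeta]. *)
pose m := Num.trunc (de / 2 / (de / 2 - zeta)).
have zm : zeta <= z m.
  have dz : 0 < de / 2 - zeta by rewrite subr_gt0.
  have /andP[_ mub] := truncn_itv (divr_ge0 (ltW d20) (ltW dz)).
  rewrite /z lerBrDr -lerBrDl (ler_pdivrMr _ _ (m0 m)) -(ler_pdivrMl _ _ dz) mulrC.
  by rewrite (le_trans (ltW mub))// ler_nat.
have [M HM] := gw m.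
have M0 : 0 <= M.
  by have := HM 0%N 0%N isT; rewrite expr0 mulr1; apply: le_trans.
apply: (hoelder_dyadic_limit (M := M)) => // n k kn.
apply: (le_trans (HM n k kn)); apply: ler_wpM2l => //.
rewrite lerXn2r ?nnegrE ?powR_ge0//; apply: ger_powR => //.
by rewrite invr_gt0 ltr0n/= invf_le1// ler1n.
Qed.

End kolmogorov.

Theorem proposition1p1 (R : realType) (d : measure_display)
    (Omega : measurableType d) (P : probability Omega R)
    (complete_P : measure_is_complete P)
    (B : R -> Omega -> R) (B_brownian : brownian_motion P B)
    (a_low a_up : R) (a_low_gt : 2^-1 < a_low) (a_le : a_low <= a_up)
    (a_up_lt : a_up < 1)
    (A : R -> Omega -> R)
    (A_continuous : forall w : Omega,
       {within `[0, 1], continuous (fun s : R => A s w)})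
    (A_adapted : adapted B A)
    (A_range : forall (s : R) (w : Omega), s \in `[0, 1] ->
       a_low <= A s w <= a_up)
    (c rho : R) (c_gt0 : 0 < c) (rho_gt0 : 0 < rho) (rho_le1 : rho <= 1)
    (A_hoelder : forall x y : R, x \in `[0, 1] -> y \in `[0, 1] ->
       ('E_P[fun w : Omega => (`|A x w - A y w| ^+ 2)%R]
          <= (c * `|x - y| `^ (2 * rho))%:E)%E)
    (X : R -> Omega -> R)
    (X_ito : forall t : R, t \in `[0, 1] ->
       is_ito_integral P B (kernel_power A t) (X t)) :
  exists Y : R -> Omega -> R,
    modification P X Y /\
    forall (w : Omega) (zeta : R), 0 < zeta -> zeta < a_low - 2^-1 ->
      hoelder_on_unit zeta (fun t : R => Y t w).
Proof.
(* With this [de] the kernel exponent [2 * a_low] is [1 + de], and the limit order [de / 2] of the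
   criterion is [a_low - 2^-1]. *)
pose be := a_low - 2^-1; pose de := 2 * be.
have de0 : 0 < de by rewrite mulr_gt0// subr_gt0.
have deE : 1 + de = 2 * a_low by rewrite /de /be; field.
(* The isometry constant times the kernel constant; it is nonnegative since [a_low < 1] gives
   [2 * be < 1]. *)
pose C := 96 * (8 + (1 - 2 * be)^-1).
have C0 : 0 <= C.
  by rewrite mulr_ge0// addr_ge0// invr_ge0 /be; lra.
have mX t : 0 <= t <= 1 -> measurable_fun setT (X t).
  by move=> t01; have [] := X_ito t; rewrite ?in_itv.
have moment_lt u t : 0 <= u -> u < t -> t <= 1 ->
    (\int[P]_w (`|X t w - X u w| ^+ 2)%:E <= (C * (t - u) `^ (1 + de))%:E)%E.
  move=> u0 ut t1.
  have itot : is_ito_integral P B (kernel_power A t) (X t).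
    by apply: X_ito; rewrite in_itv/= t1 (le_trans u0 (ltW ut)).
  have itou : is_ito_integral P B (kernel_power A u) (X u).
    by apply: X_ito; rewrite in_itv/= u0 (le_trans (ltW ut) t1).
  apply: (le_trans (ito_integral_sub_sqr_le B_brownian itot itou)).
  rewrite deE /C -mulrA EFinM lee_wpmul2l//.
  apply: (sq_norm_kernel_power_sub_le P a_low_gt a_le a_up_lt A_range) => //.
    by case: itou => -[].
  by case: itot => -[].
have moment s t : 0 <= s <= 1 -> 0 <= t <= 1 ->
    (\int[P]_w (`|X s w - X t w| ^+ 2)%:E <= (C * `|s - t| `^ (1 + de))%:E)%E.
  move=> /andP[s0 s1] /andP[t0 t1]; have [st|ts|->] := ltgtP s t.
  - under eq_integral do rewrite distrC.
    by rewrite distrC gtr0_norm ?subr_gt0// moment_lt.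
  - by rewrite gtr0_norm ?subr_gt0// moment_lt.
  - rewrite integral0_eq => [|w _]; last by rewrite subrr normr0 expr0n.
    by rewrite lee_fin (mulr_ge0 C0)// powR_ge0.
have [Y [XY Yhoelder]] := kolmogorov_continuity C0 de0 mX moment complete_P.
exists Y; split=> // w zeta z0 zlt; apply: Yhoelder => //.
by rewrite /de mulrAC divff// mul1r.
Qed.
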